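(* Let $f:\mathbb{R}^d\to\mathbb{R}^e$ and $\phi:\mathbb{R}^e\to\mathbb{R}$ be measurable functions such that $\phi\circ f$ is globally Lipschitz continuous. Let $q\ge2$ and assume that: (a) there exists an integer $m_0\ge1$ such that $\mathbb{E}\left[\min_{1\le j\le m_0}|X'_j|\right]<+\infty$; (b) there exists an open set $U\subset\mathbb{R}^d$ containing $\operatorname{supp}(\mu_X)$ such that: (i) the measure $\mu_{X'}(\cdot\cap U)$ has a density $p_{X'}$ with respect to the Lebesgue measure; (ii) $p_{X'}$ is continuous and positive on $U$; (iii) there exist $\kappa\in(0,1]$ and $r_\kappa>0$ such that for any $x\in U$ and any $r\in[0,r_\kappa]$, $\mu_{X'}(B(x,r))\ge\kappa\,p_{X'}(x)\,v_d\,r^d$; (c) with $X\sim\mu_X$, $\mathbb{E}\left[\dfrac{1+|X|^q}{p_{X'}(X)^{q/d}}\right]<+\infty$; (d) $(k_m)_{m\ge1}$ is a nondecreasing sequence of positive integers with $k_m\le m$ and $k_m/m\to0$ when $m\to+\infty$. Then, as $m,n\to+\infty$, $$\mathbb{E}\left[\left|\mathrm{QI}-\widehat{\mathrm{QI}}_{m,n}^{(k_m)}\right|^q\right]^{1/q}=\mathrm{O}\left(\frac{1}{\sqrt n}+\tau_{1,d}(n)\right)+\mathrm{O}\left(\left(\frac{k_m}{m}\right)^{1/d}\right),$$ where the first $\mathrm{O}$ is uniform in $m$ and the second is uniform in $n$.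
   Context: $|\cdot|$ is a fixed norm on $\mathbb{R}^d$ (not necessarily Euclidean), $B(x,r)=\{x':|x-x'|\le r\}$, $v_d$ is the Lebesgue volume of the unit ball of $|\cdot|$. $\mu_X,\mu_{X'}$ are probability measures on $\mathbb{R}^d$. $(X_i)_{i\ge1}$ are i.i.d. with law $\mu_X$, $(X'_j)_{j\ge1}$ are i.i.d. with law $\mu_{X'}$, and the two samples are independent; $\mathbf{X}_n=(X_1,\dots,X_n)$, $\mathbf{X}'_m=(X'_1,\dots,X'_m)$. $\operatorname{supp}(\nu)=\{x\in\mathbb{R}^d:\forall r>0,\ \nu(B(x,r))>0\}$. Noiseless case: $Y=f(X)$ with $X\sim\mu_X$, $Y'_j=f(X'_j)$, and the quantity of interest is $\mathrm{QI}=\mathbb{E}[\phi(Y)]$. Its estimator is $$\widehat{\mathrm{QI}}_{m,n}^{(k)}=\frac1m\sum_{j=1}^m w^{(k)}_j\phi(Y'_j),\qquad w^{(k)}_j:=\frac{m}{kn}\sum_{i=1}^n\sum_{l=1}^k\mathbf{1}_{\{j=j^{(l)}(X_i)\}},\qquad k\in\{1,\dots,m\},$$ where, for $x\in\mathbb{R}^d$, the indices $1,\dots,m$ are ordered by increasing distance $|x-X'_j|$, ties broken by lowest index, and $j^{(l)}(x)$ is the $l$-th index in this order. $W_1(\mu,\nu)=\inf\{\int|x-x'|\,d\gamma(x,x'):\gamma\in\Pi(\mu,\nu)\}$, with $\Pi(\mu,\nu)$ the set of couplings of $\mu$ and $\nu$; $\hat{\mu}_{\mathbf{X}_n}:=\frac1n\sum_{i=1}^n\delta_{X_i}$;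 and $(\tau_{1,d}(n))_{n\ge1}$ denotes any nonnegative sequence such that $\mathbb{E}[W_1(\mu_X,\hat{\mu}_{\mathbf{X}_n})]=\mathrm{O}(\tau_{1,d}(n))$ as $n\to+\infty$. *)

(* Defs.v *)
From HB Require Import structures.
From mathcomp Require Import all_boot all_order all_algebra.
From mathcomp Require Import all_classical all_reals all_analysis.
From mathcomp Require Import measurable_realfun.

Set Implicit Arguments.
Unset Strict Implicit.
Unset Printing Implicit Defensive.

Import Order.TTheory GRing.Theory Num.Theory.
Import numFieldNormedType.Exports.

Local Open Scope classical_set_scope.
Local Open Scope ring_scope.

Definition borel_rV_display : measure_display.
Proof. exact: default_measure_display. Qed.

(* R^d is 'rV[R]_d, with the Borel sigma-algebra of its library topology (that
   of the sup norm, hence of any norm). *)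
HB.instance Definition _ (R : realType) (d : nat) :=
  @isMeasurable.Build borel_rV_display 'rV[R]_d <<s @open 'rV[R]_d >>
    (@sigma_algebra0 _ setT _) (@sigma_algebraC _ _)
    (@sigma_algebra_bigcup _ setT _).

Lemma measurable_fun_rV (R : realType) (disp : measure_display)
    (T : measurableType disp) (d : nat) (g : T -> 'rV[R]_d) :
  (forall i, measurable_fun [set: T] (fun t => g t ord0 i)) ->
  measurable_fun [set: T] g.
Proof.
move=> mg; apply: (@measurability _ _ _ _ _ _ (@open 'rV[R]_d)) => //.
move=> _ [V oV <-]; rewrite setTI.
pose box (a : 'rV[rat]_d) (r : rat) : set 'rV[R]_d :=
  [set y | forall i, ball (ratr (a ord0 i) : R) (ratr r : R) (y ord0 i)].
pose F (k : nat) : set T :=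
  if unpickle k is Some (a, r) then
    if `[< box a r `<=` V >] then g @^-1` box a r else set0
  else set0.
have -> : g @^-1` V = \bigcup_k F k.
  apply/seteqP; split=> [t /= Vt|t [k _]]; last first.
    rewrite /F; case: (unpickle k) => [[a r]|//].
    by case: asboolP => // sub /sub.
  have /nbhs_ballP [e /= e0 eV] : nbhs (g t) V by exact: open_nbhs_nbhs.
  have e20 : 0 < e / 2 by rewrite divr_gt0.
  have [r] := rat_in_itvoo e20.
  rewrite in_itv/= => /andP[r0 re].
  have ex i : exists q : rat, ball (ratr q : R) (ratr r : R) (g t ord0 i).
    have [|q] := @rat_in_itvoo R (g t ord0 i - ratr r) (g t ord0 i + ratr r).
      by rewrite ltrBlDr -addrA ltrDl addr_gt0.
    rewrite in_itv/= => /andP[q1 q2]; exists q.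
    by rewrite /ball/= ltr_distlC; apply/andP; split;
      rewrite ?ltrBlDr// -ltrBlDr.
  pose a : 'rV[rat]_d := \row_i projT1 (cid (ex i)).
  have agt : box a r (g t) by move=> i; rewrite mxE; exact: projT2 (cid (ex i)).
  exists (pickle (a, r)) => //; rewrite /F pickleK asboolT// => y ay.
  apply: eV; split=> // i j; rewrite (ord1 i).
  apply: (@le_ball _ _ _ (ratr r + ratr r)).
    by rewrite (splitr e) lerD// ltW.
  apply: (@ball_triangle _ _ (ratr (a ord0 j) : R)); last exact: ay.
  by apply: ball_sym; exact: agt.
apply: bigcupT_measurable => k; rewrite /F.
case: (unpickle k) => [[a r]|//]; case: asboolP => // _.
rewrite (_ : _ @^-1` _ = \big[setI/setT]_(i < d)
  ((fun t => g t ord0 i) @^-1` ball (ratr (a ord0 i) : R) (ratr r : R))).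
  apply: bigsetI_measurable => i _; rewrite -[X in measurable X]setTI.
  by apply: mg => //; rewrite ball_itv; exact: measurable_itv.
rewrite -bigcap_seq; apply/seteqP; split=> t h i.
  by move=> _; exact: h i.
by apply: h => /=; exact: mem_index_enum.
Qed.

Definition rV_cons (R : realType) (d : nat)
    (p : measurableTypeR R * 'rV[R]_d) : 'rV[R]_d.+1 :=
  row_mx (p.1%:M : 'rV[R]_1) p.2.

Lemma measurable_rV_coord (R : realType) (d : nat) (i : 'I_d) :
  measurable_fun [set: 'rV[R]_d] (fun v => v ord0 i).
Proof.
apply: (measurability _ (RGenOpens.measurableE R)).
move=> _ [_ [a [b ->] <-]]; rewrite setTI; apply: sub_sigma_algebra.
apply: open_comp; last exact: interval_open.
by move=> x _; exact: coord_continuous.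
Qed.

Lemma measurable_rV_cons (R : realType) (d : nat) :
  measurable_fun [set: measurableTypeR R * 'rV[R]_d] (@rV_cons R d).
Proof.
apply: measurable_fun_rV => i.
have [j ->|j ->] := @split_ordP 1 d i.
  rewrite (_ : (fun _ => _) = fst); first exact: measurable_fst.
  apply/funext => t; rewrite /rV_cons (@row_mxEl _ 1 1 d).
  by rewrite (ord1 j) mxE eqxx mulr1n.
rewrite (_ : (fun _ => _) = (fun v : 'rV[R]_d => v ord0 j) \o snd).
  exact: measurableT_comp (measurable_rV_coord j) measurable_snd.
by apply/funext => t; rewrite /rV_cons (@row_mxEr _ 1 1 d).
Qed.

(* Lebesgue measure on R^d is built as the d-fold product of lebesgue_measure,
   transported along R * R^d -> R^(d.+1). *)
Definition lebesgue_step (R : realType) (d : nat)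
    (mu : {measure set 'rV[R]_d -> \bar R}) : set 'rV[R]_d.+1 -> \bar R :=
  pushforward (@lebesgue_measure R \x^ mu)%E (@rV_cons R d).

HB.instance Definition _ (R : realType) (d : nat)
    (mu : {measure set 'rV[R]_d -> \bar R}) :=
  Measure.copy (lebesgue_step mu)
    (measure_function_pushforward__canonical__measure_function_Measure
      (@lebesgue_measure R \x^ mu)%E (@measurable_rV_cons R d)).

Fixpoint lebesgue_rV (R : realType) (d : nat) :
    {measure set 'rV[R]_d -> \bar R} :=
  if d is d'.+1 then lebesgue_step (lebesgue_rV R d')
  else dirac (0 : 'rV[R]_0).

Record is_norm (R : realType) (d : nat) (nrm : 'rV[R]_d -> R) : Prop := IsNorm {
  is_norm_triangle : forall x y, nrm (x + y) <= nrm x + nrm y ;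
  is_norm_scale : forall (a : R) x, nrm (a *: x) = `|a| * nrm x ;
  is_norm_definite : forall x, nrm x = 0 -> x = 0 }.

Definition nball (R : realType) (d : nat) (nrm : 'rV[R]_d -> R)
    (x : 'rV[R]_d) (r : R) : set 'rV[R]_d :=
  [set y | nrm (x - y) <= r].

Definition unit_ball_volume (R : realType) (d : nat) (nrm : 'rV[R]_d -> R)
    : \bar R :=
  lebesgue_rV R d (nball nrm 0 1).

Definition msupp (R : realType) (d : nat) (nrm : 'rV[R]_d -> R)
    (nu : set 'rV[R]_d -> \bar R) : set 'rV[R]_d :=
  [set x | forall r : R, 0 < r -> (0 < nu (nball nrm x r))%E].

Definition has_density (disp : measure_display) (T : measurableType disp)
    (R : realType) (nu lambda : set T -> \bar R) (p : T -> R) : Prop :=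
  [/\ measurable_fun [set: T] p, (forall x, 0 <= p x) &
      forall A, measurable A -> nu A = (\int[lambda]_(x in A) (p x)%:E)%E].

Definition has_law (disp disp' : measure_display) (Omega : measurableType disp)
    (T : measurableType disp') (R : realType) (P : probability Omega R)
    (Z : {RV P >-> T}) (mu : set T -> \bar R) : Prop :=
  forall A, measurable A -> distribution P Z A = mu A.

Definition mutually_independent (disp disp' : measure_display)
    (Omega : measurableType disp) (T : measurableType disp') (R : realType)
    (P : probability Omega R) (Z : nat -> {RV P >-> T}) : Prop :=
  forall (s : seq nat) (B : nat -> set T),
    uniq s -> (forall i, measurable (B i)) ->
    P (\bigcap_(i in [set` s]) (Z i @^-1` B i)) =
    (\prod_(i <- s) P (Z i @^-1` B i))%E.

Definition iid (disp disp' : measure_display)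
    (Omega : measurableType disp) (T : measurableType disp') (R : realType)
    (P : probability Omega R) (Z : nat -> {RV P >-> T})
    (mu : set T -> \bar R) : Prop :=
  mutually_independent Z /\ forall i, has_law (Z i) mu.

Definition sigma_generated (disp disp' : measure_display)
    (Omega : measurableType disp) (T : measurableType disp') (R : realType)
    (P : probability Omega R) (Z : nat -> {RV P >-> T}) : set (set Omega) :=
  <<s \bigcup_i preimage_set_system [set: Omega] (Z i) measurable >>.

Definition independent_samples (disp disp' : measure_display)
    (Omega : measurableType disp) (T : measurableType disp') (R : realType)
    (P : probability Omega R) (Z Z' : nat -> {RV P >-> T}) : Prop :=
  forall A B, sigma_generated Z A -> sigma_generated Z' B ->
    P (A `&` B) = (P A * P B)%E.

Definition coupling (R : realType) (d : nat) (mu nu : set 'rV[R]_d -> \bar R)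
    : set (probability ('rV[R]_d * 'rV[R]_d)%type R) :=
  [set gamma | forall A, measurable A ->
    gamma (A `*` setT) = mu A /\ gamma (setT `*` A) = nu A].

Definition W1 (R : realType) (d : nat) (nrm : 'rV[R]_d -> R)
    (mu nu : set 'rV[R]_d -> \bar R) : \bar R :=
  ereal_inf [set (\int[gamma]_z (nrm (z.1 - z.2))%:E)%E
            | gamma in coupling mu nu].

(* Samples are sequences indexed from 0: x 0, ..., x n.-1 are the first n
   points, and likewise for sample and rank indices below. *)
Definition empirical_measure (R : realType) (d : nat) (x : nat -> 'rV[R]_d)
    (n : nat) (A : set 'rV[R]_d) : \bar R :=
  (n%:R^-1%:E * \sum_(i < n) dirac (x i) A)%E.

Definition closer (R : realType) (d : nat) (nrm : 'rV[R]_d -> R)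
    (x' : nat -> 'rV[R]_d) (x : 'rV[R]_d) (i j : nat) : bool :=
  (nrm (x - x' i) < nrm (x - x' j)) ||
  ((nrm (x - x' i) == nrm (x - x' j)) && (i <= j)%N).

(* nn_index nrm m x' x l is j^(l+1)(x); the default value of nth is only
   reached when m <= l. *)
Definition nn_index (R : realType) (d : nat) (nrm : 'rV[R]_d -> R) (m : nat)
    (x' : nat -> 'rV[R]_d) (x : 'rV[R]_d) (l : nat) : nat :=
  nth m (sort (closer nrm x' x) (iota 0 m)) l.

Definition nn_weight (R : realType) (d : nat) (nrm : 'rV[R]_d -> R)
    (k m n : nat) (x x' : nat -> 'rV[R]_d) (j : nat) : R :=
  m%:R / (k%:R * n%:R) *
    \sum_(i < n) \sum_(l < k) (j == nn_index nrm m x' (x i) l)%:R.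

Definition QI_estimator (R : realType) (d e : nat) (nrm : 'rV[R]_d -> R)
    (f : 'rV[R]_d -> 'rV[R]_e) (phi : 'rV[R]_e -> R)
    (k m n : nat) (x x' : nat -> 'rV[R]_d) : R :=
  m%:R^-1 * \sum_(j < m) nn_weight nrm k m n x x' j * phi (f (x' j)).

Definition QI (R : realType) (d e : nat) (muX : probability 'rV[R]_d R)
    (f : 'rV[R]_d -> 'rV[R]_e) (phi : 'rV[R]_e -> R) : R :=
  fine ('E_muX[phi \o f])%E.

(* Main.v *)
(** Write g = phi o f. The estimator is the average over i <= n and l <= k of g at
    the l-th neighbour of X_i, so that its distance to QI is at most
    |QI - (1/n) sum_i g(X_i)| plus the average of L |X_i - X'_{j_l(X_i)}|.

    The first term is O(1/sqrt n) in L^q by a Marcinkiewicz-Zygmund inequality: (iii)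
    at r = r_kappa bounds p on U, so that (c) gives a q-th moment to g(X).

    For the second term, cut the first 2kM points of X' into 2k blocks of size
    M ~ m/(2k). Fewer than k blocks contain a point closer to x than the l-th neighbour
    (l <= k), so the q-th power of its distance is at most (1/k) times the sum over
    blocks of the q-th powers of the distances to the blocks. This reduces k neighbours
    among m points to one neighbour among M, whose distance to x exceeds r with
    probability (1 - mu_X'(B(x,r)))^M <= K (S/r)^(q+1), S = (1+|x|)/(M p(x))^(1/d):
    use (iii) for r <= r_kappa, monotonicity for r = O(1+|x|), and (a) beyond.
    Integrating the tail bounds the q-th moment by a multiple of S^q, and (c) makes
    it integrable in x. *)

Require Import Defs.
From HB Require Import structures.
From mathcomp Require Import all_boot all_order all_algebra.
From mathcomp Require Import all_classical all_reals all_analysis.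
From mathcomp Require Import measurable_realfun ring lra.

Set Implicit Arguments.
Unset Strict Implicit.
Unset Printing Implicit Defensive.

Import Order.TTheory GRing.Theory Num.Theory.
Import numFieldNormedType.Exports.

Local Open Scope classical_set_scope.
Local Open Scope ring_scope.

(** * Inequalities between real powers *)

Lemma powR_ge1 (R : realType) (x q : R) : 1 <= x -> 0 <= q -> 1 <= x `^ q.
Proof. by move=> x1 q0; rewrite -[X in X <= _](powRr0 x); exact: ler_powR. Qed.

(** Young's inequality for y and x^(q-1), with conjugate exponents q and q/(q-1), rearranges into
    this convexity bound. The case q = 1 is separate because its conjugate exponent is infinite. *)
Lemma powR_tangent (R : realType) (q x y : R) :
  1 <= q -> 0 <= x -> 0 <= y ->
  x `^ q + q * x `^ (q - 1) * (y - x) <= y `^ q.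
Proof.
move=> q1 x0 y0; have q0 : 0 < q by rewrite (lt_le_trans ltr01).
have [->|qn1] := eqVneq q 1.
  by rewrite subrr powRr0 !powRr1// !mul1r addrC subrK.
have q10 : 0 < q - 1 by rewrite subr_gt0 lt_neqAle eq_sym qn1.
have := @conjugate_powR R y (x `^ (q - 1)) q (q / (q - 1)) y0 (powR_ge0 _ _) q0.
rewrite divr_gt0// => /(_ isT).
have -> : q^-1 + (q / (q - 1))^-1 = 1 by field; rewrite !gt_eqF.
move=> /(_ erefl); rewrite -powRrM.
have -> : (q - 1) * (q / (q - 1)) = q by field; rewrite gt_eqF.
have -> : x `^ q / (q / (q - 1)) = x `^ q * (q - 1) / q by field; rewrite !gt_eqF.
rewrite -mulrDl ler_pdivlMr// => H.
rewrite mulrBr -[X in _ - X]mulrA [X in _ - _ * X]mulrC mulr_powRB1//.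
by move: H; lra.
Qed.

(** Jensen's inequality from the tangent at the mean [m]: summed over i, the linear terms cancel. *)
Lemma powR_mean (R : realType) (q : R) (n : nat) (a : nat -> R) :
  1 <= q -> (0 < n)%N -> (forall i, 0 <= a i) ->
  (n%:R^-1 * \sum_(i < n) a i) `^ q <= n%:R^-1 * \sum_(i < n) (a i) `^ q.
Proof.
move=> q1 n0 a0; set m := n%:R^-1 * _.
have n0' : 0 < n%:R :> R by rewrite ltr0n.
have m0 : 0 <= m.
  by rewrite mulr_ge0 ?invr_ge0 ?ler0n// sumr_ge0.
have : \sum_(i < n) (m `^ q + q * m `^ (q - 1) * (a i - m)) <= \sum_(i < n) a i `^ q.
  by apply: ler_sum => i _; exact: powR_tangent.
rewrite big_split/= -mulr_sumr big_split/= !sumr_const card_ord.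
rewrite -[m `^ q *+ n]mulr_natl -[- m *+ n]mulr_natl.
have -> : \sum_(i < n) a i = n%:R * m by rewrite /m mulrA divff ?mul1r// gt_eqF.
have -> : n%:R * m + n%:R * (- m) = 0 by ring.
by rewrite mulr0 addr0 mulrC -ler_pdivlMr// mulrC.
Qed.

Lemma powR_subr2 (R : realType) (q z : R) : 2 <= q -> 0 <= z ->
  z `^ q = z `^ (q - 2) * z ^+ 2.
Proof.
move=> q2; rewrite le_eqVlt => /predU1P[<-|z0].
  by rewrite expr0n mulr0 powR0// gt_eqF//; lra.
by rewrite -powR_mulrn ?ltW// -powRD ?subrK// (gt_eqF z0) implybT.
Qed.

(** A second-order Taylor bound from tangents alone. The tangent at 1 + t gives (1 + t)^q <= 1 + q t
    (1 + t)^(q-1); the last power is then compared with its own tangent, at 1 + t if t >= 0 and at 1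
    if t < 0. *)
Lemma powR_linear_bound (R : realType) (q t : R) : 2 <= q -> `|t| <= 1 ->
  (1 + t) `^ q <= 1 + q * t + q * (q - 1) * 2 `^ q * t ^+ 2.
Proof.
move=> q2; rewrite ler_norml => /andP[tl tr].
have t0 : 0 <= 1 + t by lra.
have := @powR_tangent R q (1 + t) 1; rewrite powR1 => /(_ ltac:(lra) t0 ltac:(lra)).
have c2 : 1 <= 2 `^ q :> R by apply: powR_ge1; lra.
suff : t * (1 + t) `^ (q - 1) <= t + (q - 1) * 2 `^ q * t ^+ 2.
  rewrite -(ler_pM2l (_ : 0 < q)); [nra|lra].
have [tp|tn] := leP 0 t.
- have := @powR_tangent R (q - 1) (1 + t) 1; rewrite powR1.
  move=> /(_ ltac:(lra) t0 ltac:(lra)).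
  have : (1 + t) `^ (q - 1 - 1) <= 2 `^ q.
    apply: (@le_trans _ _ (2 `^ (q - 1 - 1))); last by apply: ler_powR; lra.
    by apply: ge0_ler_powR; rewrite ?nnegrE; lra.
  move: (_ `^ (q - 1 - 1)) (_ `^ (q - 1)) (_ `^ q) c2 => a b c c2 ac H.
  have : b <= 1 + (q - 1) * c * t.
    have : (q - 1) * a * t <= (q - 1) * c * t.
      by rewrite ler_wpM2r// ler_wpM2l//; lra.
    by move: H; lra.
  by move=> /(ler_wpM2l tp); rewrite expr2; lra.
- have := @powR_tangent R (q - 1) 1 (1 + t); rewrite !powR1.
  move=> /(_ ltac:(lra) ltac:(lra) t0).
  move: (_ `^ (q - 1)) (_ `^ q) c2 => b c c2 H.
  have : (1 + (q - 1) * t) * (- t) <= b * (- t) by rewrite ler_wpM2r; lra.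
  have : 0 <= (q - 1) * t ^+ 2 * (c - 1).
    by apply: mulr_ge0; [apply: mulr_ge0; [lra|exact: sqr_ge0]|lra].
  by rewrite expr2; lra.
Qed.

(** If |b| <= |a|, factor out a and use [powR_linear_bound] at t = b/a; otherwise |a + b|^q and the
    linear term are both controlled by |b|^q. The term linear in b is kept exact because its
    expectation will vanish. *)
Lemma normr_powRD2 (R : realType) (q : R) : 2 <= q -> exists2 c : R, 0 < c &
  forall a b : R, `|a + b| `^ q <=
    `|a| `^ q + q * (`|a| `^ (q - 2) * a) * b +
    c * (`|a| `^ (q - 2) * b ^+ 2 + `|b| `^ q).
Proof.
move=> q2.
have c2 : 1 <= 2 `^ q :> R by apply: powR_ge1; lra.
exists (q * (q - 1) * 2 `^ q + (2 `^ q + q)).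
  by rewrite addr_gt0 ?mulr_gt0; lra.
move=> a b; set c1 := q * (q - 1) * 2 `^ q; set c2' := 2 `^ q + q.
have c1p : 0 <= c1 by rewrite !mulr_ge0; lra.
have c2p : 0 <= c2' by rewrite /c2'; lra.
have A0 : 0 <= `|a| `^ (q - 2) by exact: powR_ge0.
have B0 : 0 <= `|b| `^ q by exact: powR_ge0.
have AB : 0 <= `|a| `^ (q - 2) * b ^+ 2 by rewrite mulr_ge0// sqr_ge0.
have [ba|ab] := leP `|b| `|a|.
  have [a0|a0] := eqVneq a 0.
    have b0 : b = 0 by apply/eqP; rewrite -normr_le0 (le_trans ba)// a0 normr0.
    rewrite a0 b0 addr0 normr0 powR0; last by rewrite gt_eqF; lra.
    by rewrite expr0n/= !(mulr0, addr0).
  have an0 : 0 < `|a| by rewrite normr_gt0.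
  have -> : a + b = a * (1 + b / a) by rewrite mulrDr mulr1 mulrC divfK.
  have t1 : `|b / a| <= 1 by rewrite normf_div ler_pdivrMr// mul1r.
  rewrite normrM powRM// (ger0_norm (_ : 0 <= 1 + b / a)); last first.
    by move: t1; rewrite ler_norml; lra.
  have := @powR_linear_bound R q _ q2 t1.
  move=> /(ler_wpM2l (powR_ge0 `|a| q)) /le_trans; apply.
  have -> : `|a| `^ q = `|a| `^ (q - 2) * a ^+ 2.
    by rewrite -(real_normK (num_real a)) powR_subr2.
  rewrite -/c1.
  have -> : `|a| `^ (q - 2) * a ^+ 2 * (1 + q * (b / a) + c1 * (b / a) ^+ 2) =
    `|a| `^ (q - 2) * a ^+ 2 + q * (`|a| `^ (q - 2) * a) * b + c1 * (`|a| `^ (q - 2) * b ^+ 2).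
    by move: (_ `^ (q - 2)) => z; field.
  by rewrite lerD2l; apply: ler_pM => //; rewrite lerDl.
have b0 : 0 < `|b| by rewrite (le_lt_trans _ ab).
have : `|a + b| `^ q <= 2 `^ q * `|b| `^ q.
  rewrite -powRM//; apply: ge0_ler_powR; rewrite ?nnegrE ?mulr_ge0//; first lra.
  by rewrite (le_trans (ler_normD _ _))// ; lra.
have H : - (q * (`|a| `^ (q - 2) * a) * b) <= q * `|b| `^ q.
  apply: (le_trans (ler_norm _)).
  have q0 : 0 <= q by lra.
  rewrite normrN !normrM (ger0_norm A0) (ger0_norm q0).
  rewrite -!mulrA; apply: ler_wpM2l => //.
  have -> : `|b| `^ q = `|b| `^ (q - 2) * (`|b| * `|b|).
    by rewrite -expr2 powR_subr2.
  apply: ler_pM => //.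
    by apply: ge0_ler_powR; rewrite ?nnegrE//; [lra|exact: ltW].
  by rewrite ler_wpM2r// ltW.
move=> H2.
have : 0 <= `|a| `^ q by exact: powR_ge0.
have : 0 <= c1 * (`|a| `^ (q - 2) * b ^+ 2 + `|b| `^ q) by rewrite mulr_ge0// addr_ge0.
have : 0 <= c2' * (`|a| `^ (q - 2) * b ^+ 2) by rewrite mulr_ge0.
have : c2' * `|b| `^ q = 2 `^ q * `|b| `^ q + q * `|b| `^ q by rewrite /c2' mulrDl.
rewrite (mulrDl c1 c2') (mulrDr c2').
move: (c1 * _) (c2' * _) (c2' * _) H H2 => u v w; lra.
Qed.

(** A weighted Young inequality, by cases on y^2 <= l x^2: in each case one of the two terms on the
    right dominates alone. *)
Lemma powR_split2 (R : realType) (q l x y : R) : 2 <= q -> 0 < l -> 0 <= x -> 0 <= y ->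
  x `^ (q - 2) * y ^+ 2 <= l * x `^ q + l `^ (- ((q - 2) / 2)) * y `^ q.
Proof.
move=> q2 l0 x0 y0.
have e (z : R) : 0 <= z -> z `^ q = z `^ (q - 2) * z ^+ 2 by exact: powR_subr2.
have [yx|xy] := leP (y ^+ 2) (l * x ^+ 2).
  rewrite (e x)// [l * _]mulrCA; apply: ler_wpDr; first by rewrite mulr_ge0// powR_ge0.
  by apply: ler_wpM2l => //; exact: powR_ge0.
apply: ler_wpDl; first by rewrite mulr_ge0// ?powR_ge0// ltW.
rewrite (e y)// mulrA ler_wpM2r ?sqr_ge0//.
have -> : l `^ (- ((q - 2) / 2)) = (l^-1) `^ ((q - 2) / 2).
  by rewrite -(powR_inv1 (ltW l0)) -powRrM mulN1r.
have h (z : R) : 0 <= z -> z `^ (q - 2) = (z ^+ 2) `^ ((q - 2) / 2).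
  by move=> z0; rewrite -powR_mulrn// -powRrM mulrCA divff ?mulr1.
have li : 0 <= l^-1 by rewrite invr_ge0 ltW.
rewrite h// [X in _ <= _ * X]h// -powRM ?sqr_ge0//.
apply: ge0_ler_powR; rewrite ?nnegrE ?sqr_ge0//.
- by apply: divr_ge0; lra.
- by rewrite mulr_ge0// sqr_ge0.
- by rewrite ler_pdivlMl// ltW.
Qed.

(** Raise z/a <= exp(z/a) to the power a. *)
Lemma powR_le_expR (R : realType) (a z : R) : 0 < a -> 0 <= z ->
  z `^ a <= a `^ a * expR z.
Proof.
move=> a0 z0.
have -> : expR z = expR (z / a) `^ a.
  by rewrite -[X in _ = X]expRM ?divfK// gt_eqF.
have a0' := ltW a0.
rewrite -powRM ?expR_ge0//; apply: ge0_ler_powR; rewrite ?nnegrE ?mulr_ge0 ?expR_ge0//.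
rewrite mulrC -ler_pdivrMr//; apply: (le_trans _ (expR_ge1Dx _)); lra.
Qed.

(** From (1 - u)^M <= exp(-M u) and z^a exp(-z) <= a^a at z = M u. *)
Lemma powR_expr_bound (R : realType) (a u : R) (M : nat) : 0 < a -> 0 <= u <= 1 ->
  (M%:R * u) `^ a * (1 - u) ^+ M <= a `^ a.
Proof.
move=> a0 /andP[u0 u1].
have H : (1 - u) ^+ M <= expR (- (M%:R * u)).
  rewrite -mulrN mulrC expRM_natr.
  by apply: lerXn2r; rewrite ?nnegrE ?expR_ge0 ?subr_ge0// expR_ge1Dx.
apply: (le_trans (ler_wpM2l (powR_ge0 _ _) H)).
by rewrite expRN ler_pdivrMr ?expR_gt0// powR_le_expR// mulr_ge0.
Qed.

(** * Norms, supports and volumes in R^d *)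

Section norm.
Context (R : realType) (d : nat) (nrm : 'rV[R]_d -> R) (hn : is_norm nrm).

Lemma is_norm0 : nrm 0 = 0.
Proof. by rewrite -(scale0r 0) (is_norm_scale hn) normr0 mul0r. Qed.

Lemma is_normN x : nrm (- x) = nrm x.
Proof. by rewrite -scaleN1r (is_norm_scale hn) normrN1 mul1r. Qed.

Lemma is_norm_ge0 x : 0 <= nrm x.
Proof.
have := is_norm_triangle hn x (- x); rewrite subrr is_norm0 is_normN; lra.
Qed.

Lemma is_norm_sum (n : nat) (F : 'I_n -> 'rV[R]_d) :
  nrm (\sum_i F i) <= \sum_i nrm (F i).
Proof.
elim/big_ind2: _ => [||//]; first by rewrite is_norm0.
by move=> x1 x2 y1 y2 h1 h2; rewrite (le_trans (is_norm_triangle hn _ _))// lerD.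
Qed.

Lemma is_norm_distC x y : nrm (x - y) = nrm (y - x).
Proof. by rewrite -is_normN opprB. Qed.

Lemma is_norm_le_coord x :
  nrm x <= \sum_i `|x ord0 i| * nrm (delta_mx ord0 i).
Proof.
rewrite {1}(row_sum_delta x) (le_trans (is_norm_sum _))//.
by apply: ler_sum => i _; rewrite (is_norm_scale hn).
Qed.

Lemma is_norm_lip x y : `|nrm x - nrm y| <= nrm (x - y).
Proof.
rewrite ler_norml; apply/andP; split.
  have := is_norm_triangle hn (y - x) x; rewrite subrK is_norm_distC; lra.
have := is_norm_triangle hn (x - y) y; rewrite subrK; lra.
Qed.

(** Domination by the sup norm, the source of the continuity of [nrm] and of cubes inside its balls.
    The 1 added to the sum of the norms of the basis vectors keeps the constant positive even for d
    = 0. *)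
Lemma is_norm_le_box : exists2 c : R, 0 < c & forall (x : 'rV[R]_d) (r : R), 0 <= r ->
  (forall i, `|x ord0 i| <= r) -> nrm x <= c * r.
Proof.
have S0 : 0 <= \sum_i nrm (delta_mx ord0 i).
  by apply: sumr_ge0 => i _; exact: is_norm_ge0.
exists (1 + \sum_i nrm (delta_mx ord0 i)); first by rewrite ltr_pwDl.
move=> x r r0 xr; rewrite (le_trans (is_norm_le_coord x))// mulrDl mul1r.
rewrite ler_wpDl// mulr_suml; apply: ler_sum => i _.
by rewrite mulrC ler_wpM2l// is_norm_ge0.
Qed.

Lemma is_norm_continuous : continuous nrm.
Proof.
have [c c0 hc] := is_norm_le_box.
move=> x A /= /(nbhs_ballP (nrm x)) [e e0 eA]; apply/nbhs_ballP.
have e1 : 0 < e / 2 / c by rewrite !divr_gt0.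
exists (e / 2 / c) => //= y [_ xy]; apply: eA; rewrite /ball/=.
rewrite (le_lt_trans (is_norm_lip _ _))// (@le_lt_trans _ _ (c * (e / 2 / c)))//.
  by apply: hc => [|i]; [exact: ltW|rewrite !mxE; exact/ltW/xy].
by rewrite mulrC divfK ?gt_eqF// ltr_pdivrMr// ltr_pMr// ltr1n.
Qed.

Lemma measurable_is_norm : measurable_fun [set: 'rV[R]_d] nrm.
Proof.
apply: (measurability _ (RGenOpens.measurableE R)).
move=> _ [_ [a [b ->] <-]]; rewrite setTI; apply: sub_sigma_algebra.
apply: open_comp; last exact: interval_open.
by move=> x _; exact: is_norm_continuous.
Qed.

Lemma measurable_nball x r : measurable (nball nrm x r).
Proof.
rewrite -[nball _ _ _]setTI.
rewrite (_ : nball nrm x r = (fun y => nrm (x - y)) @^-1` [set z | z <= r]); last by [].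
have -> : [set z : R | z <= r] = `]-oo, r]%classic.
  by apply/seteqP; split => z /=; rewrite in_itv.
suff m : measurable_fun setT (fun y : 'rV[R]_d => nrm (x - y)) by apply: m => //.
apply: (@measurableT_comp _ _ _ _ _ _ nrm) => //; first exact: measurable_is_norm.
apply: measurable_fun_rV => i.
rewrite (_ : (fun _ => _) = fun y : 'rV[R]_d => x ord0 i - y ord0 i).
  apply: measurable_funB => //; exact: measurable_rV_coord.
by apply/funext => y; rewrite !mxE.
Qed.

End norm.

Lemma measurable_rV_sub (R : realType) (d : nat) (disp : measure_display)
    (T : measurableType disp) (g h : T -> 'rV[R]_d) :
  measurable_fun [set: T] g -> measurable_fun [set: T] h ->
  measurable_fun [set: T] (fun t => g t - h t).
Proof.
move=> mg mh; apply: measurable_fun_rV => i.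
rewrite (_ : (fun _ => _) = fun t => g t ord0 i - h t ord0 i).
  by apply: measurable_funB; apply: measurableT_comp (measurable_rV_coord i) _.
by apply/funext => y; rewrite !mxE.
Qed.

(** Read off the supremum over simple functions that defines the integral of a nonnegative
    function. *)
Lemma ge0_le_integralT (disp : measure_display) (T : measurableType disp)
    (R : realType) (mu : {measure set T -> \bar R}) (f g : T -> \bar R) :
  (forall x, (0 <= f x)%E) -> (forall x, (f x <= g x)%E) ->
  (\int[mu]_x f x <= \int[mu]_x g x)%E.
Proof.
move=> f0 fg; rewrite !ge0_integralTE//; last first.
  by move=> x; rewrite (le_trans (f0 x)).
by apply: ub_ereal_sup => _ [h hf <-]; apply: ereal_sup_ubound;
  exists h => // x; rewrite (le_trans (hf x)).
Qed.
(** Closed balls of the sup norm: their volume is computed by induction on [d], and those with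
    rational data form a countable family. *)
Definition cube (R : realType) (d : nat) (x : 'rV[R]_d) (r : R) : set 'rV[R]_d :=
  [set y | forall i, `|x ord0 i - y ord0 i| <= r].

Lemma measurable_cube (R : realType) (d : nat) (x : 'rV[R]_d) (r : R) :
  measurable (cube x r).
Proof.
rewrite (_ : cube x r = \big[setI/setT]_(i < d)
    ((fun t : 'rV[R]_d => t ord0 i) @^-1` `[x ord0 i - r, x ord0 i + r]%classic)).
  apply: bigsetI_measurable => i _; rewrite -[X in measurable X]setTI.
  exact: measurable_rV_coord.
rewrite -bigcap_seq; apply/seteqP; split=> [y h i _|y h i].
  by rewrite /= in_itv/= -ler_distlC; exact: h.
by have := h i (mem_index_enum _); rewrite /= in_itv/= -ler_distlC.
Qed.

(** Along [rV_cons] the cube of dimension d + 1 is an interval of length 2r times the cube of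
    dimension d; in dimension 0 it is the point charged by the Dirac mass. *)
Lemma lebesgue_rV_cube_gt0 (R : realType) (d : nat) (r : R) : 0 < r ->
  (0 < lebesgue_rV R d (cube 0 r))%E.
Proof.
move=> r0; elim: d => [|d IH].
  by rewrite /= diracE (_ : _ \in _) ?lte01// inE => -[].
rewrite (_ : lebesgue_rV R d.+1 (cube 0 r) =
    (@lebesgue_measure R \x^ lebesgue_rV R d) (`[- r, r]%classic `*` cube 0 r)%R)%E.
  rewrite product_measure2E//; last exact: measurable_cube.
  apply: mule_gt0 => //; rewrite [X in (_ < X)%E](_ : _ = lebesgue_measure `[- r, r]%classic)//.
  by rewrite lebesgue_measure_itv/= lte_fin ifT ?lte_fin; lra.
rewrite /= /lebesgue_step /pushforward; congr (_ _).
apply/seteqP; split=> -[a v] /=.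
  move=> h; split=> /=.
    have := h (@lshift 1 d ord0); rewrite /rV_cons (@row_mxEl _ 1 1 d) !mxE eqxx mulr1n.
    by rewrite sub0r normrN in_itv/= -ler_norml.
  by move=> i; have := h (@rshift 1 d i); rewrite /rV_cons (@row_mxEr _ 1 1 d) !mxE.
move=> [ha hv] i; have [j ->|j ->] := @split_ordP 1 d i.
  rewrite /rV_cons (@row_mxEl _ 1 1 d) (ord1 j) !mxE eqxx mulr1n sub0r normrN.
  by move: ha; rewrite /= in_itv/= -ler_norml.
by rewrite /rV_cons (@row_mxEr _ 1 1 d); have := hv j; rewrite !mxE.
Qed.

Lemma unit_ball_volume_gt0 (R : realType) (d : nat) (nrm : 'rV[R]_d -> R) :
  is_norm nrm -> (0 < unit_ball_volume nrm)%E.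
Proof.
move=> hn; have [c c0 hc] := is_norm_le_box hn.
apply: (lt_le_trans (@lebesgue_rV_cube_gt0 R d c^-1 _)); first by rewrite invr_gt0.
apply: le_measure; rewrite ?inE.
- exact: measurable_cube.
- exact: measurable_nball.
- move=> y h; rewrite /nball/= -(divff (lt0r_neq0 c0)).
  by apply: hc => [|i]; [rewrite invr_ge0 ltW|have := h i; rewrite !mxE].
Qed.

(** Second countability: each point outside U lies in a null ball, hence in a null cube with
    rational data. [F] enumerates these cubes, and a countable union of them is null. *)
Lemma msupp_open_null (R : realType) (d : nat) (nrm : 'rV[R]_d -> R)
    (mu : probability 'rV[R]_d R) (U : set 'rV[R]_d) :
  is_norm nrm -> open U -> msupp nrm mu `<=` U -> mu (~` U) = 0%E.
Proof.
move=> hn oU sU; have [c c0 hc] := is_norm_le_box hn.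
pose bx (a : 'rV[rat]_d) (r : rat) : set 'rV[R]_d := cube (map_mx ratr a) (ratr r).
pose F (k : nat) : set 'rV[R]_d :=
  if unpickle k is Some (a, r) then
    if mu (bx a r) == 0%E then bx a r else set0
  else set0.
have mF k : measurable (F k).
  rewrite /F; case: (unpickle k) => [[a r]|//].
  by case: ifP => // _; exact: measurable_cube.
have F0 k : mu (F k) = 0%E.
  rewrite /F; case: (unpickle k) => [[a r]|]; rewrite ?measure0//.
  by case: ifP => [/eqP//|_]; rewrite measure0.
have mU : measurable (~` U) by apply: measurableC; apply: sub_sigma_algebra.
suff sF : ~` U `<=` \bigcup_k F k.
  apply/eqP; rewrite eq_le measure_ge0 andbT.
  rewrite (le_trans (measure_sigma_subadditive mu mF mU sF))//.
  by rewrite eseries0// => i _ _; exact: F0.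
move=> x Ux; have : ~ msupp nrm mu x by move=> /sU.
move=> /existsNP[r /not_implyP[r0 /negP]]; rewrite -leNgt => mr.
have {mr} mr : mu (nball nrm x r) = 0%E.
  by apply/eqP; rewrite eq_le mr measure_ge0.
(* A cube of half-side s whose centre is within s of x stays within sup distance 2s < r/c of x,
   hence inside B(x, r). *)
have e0 : 0 < r / (2 * c) by rewrite divr_gt0// mulr_gt0.
have [s] := rat_in_itvoo e0; rewrite in_itv/= => /andP[s0 sr].
have ex i : exists q : rat, `|ratr q - x ord0 i| <= ratr s.
  have [|q] := @rat_in_itvoo R (x ord0 i - ratr s) (x ord0 i + ratr s).
    by rewrite ltrBlDr -addrA ltrDl addr_gt0.
  by rewrite in_itv/= -ltr_distlC => h; exists q; rewrite distrC ltW.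
pose a : 'rV[rat]_d := \row_i projT1 (cid (ex i)).
have ha i : `|(map_mx ratr a : 'rV[R]_d) ord0 i - x ord0 i| <= ratr s.
  by rewrite !mxE; exact: projT2 (cid (ex i)).
exists (pickle (a, s)) => //; rewrite /F pickleK.
suff -> : mu (bx a s) == 0%E by move=> i; exact: ha.
rewrite eq_le measure_ge0 andbT -mr; apply: le_measure; rewrite ?inE.
- exact: measurable_cube.
- exact: measurable_nball.
- move=> y hy; rewrite /nball/= (_ : r = c * (r / c)); last by rewrite mulrC divfK ?gt_eqF.
  apply: hc => [|i]; first by rewrite divr_ge0 ?ltW.
  rewrite !mxE -(subrKA ((map_mx ratr a : 'rV[R]_d) ord0 i)) (le_trans (ler_normD _ _))//.
  rewrite distrC (le_trans (lerD (ha i) (hy i)))//.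
  move: sr; rewrite invfM mulrA mulrAC => sr.
  by move: (r / c) sr => z; lra.
Qed.

(** * Independence *)

Lemma probability_indep_setC (disp : measure_display) (T : measurableType disp)
    (R : realType) (P : probability T R) (A B : set T) :
  measurable A -> measurable B -> P (A `&` B) = (P A * P B)%E ->
  P (~` A `&` B) = (P (~` A) * P B)%E.
Proof.
move=> mA mB AB; have H : (P (B `\` A) = P B - P (A `&` B))%E.
  by rewrite setIC; apply: measureD => //; rewrite ltey_eq fin_num_measure.
rewrite setIC -setDE H AB.
rewrite probability_setC//.
rewrite -[P A]fineK ?fin_num_measure// -[P B]fineK ?fin_num_measure//.
by rewrite muleBl// mul1e.
Qed.

(** Dynkin's pi-lambda argument: the events independent of B form a lambda-system. *)
Lemma indep_sigma_algebra (disp : measure_display) (T : measurableType disp)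
    (R : realType) (P : probability T R) (G : set (set T)) (B : set T) :
  setI_closed G -> G `<=` measurable -> measurable B ->
  (forall A, G A -> P (A `&` B) = (P A * P B)%E) ->
  forall A, <<s G >> A -> P (A `&` B) = (P A * P B)%E.
Proof.
move=> GI Gm mB GB A sGA.
suff: <<s G >> `<=` [set A | measurable A /\ P (A `&` B) = (P A * P B)%E].
  by move=> /(_ _ sGA)[].
apply: lambda_system_subset; [by []| | |by []].
- apply/dynkin_lambda_system; split => //.
  + by split => //; rewrite setTI probability_setT mul1e.
  + by move=> D [mD PD]; split; [exact: measurableC|exact: probability_indep_setC].
  + move=> F tF Hm; have mF n : measurable (F n) by have [] := Hm n.
    split; first exact: bigcup_measurable.
    rewrite setI_bigcupl measure_bigcup//; last 2 first.
      by move=> n _; exact: measurableI.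
      exact: trivIset_setIr.
    rewrite measure_bigcup// muleC -[P B]fineK ?fin_num_measure// -nneseriesZl//.
    apply: eq_eseriesr => n _; have [_ FB] := Hm n.
    by rewrite [LHS]FB muleC fineK// fin_num_measure.
- by move=> C GC; split; [exact: Gm|exact: GB].
Qed.

(** The joint law agrees with the product measure on rectangles, hence everywhere; Tonelli
    concludes. *)
Lemma integral_indep (d1 d2 disp : measure_display) (T1 : measurableType d1)
    (T2 : measurableType d2) (T : measurableType disp) (R : realType)
    (P : probability T R) (m1 : probability T1 R) (m2 : probability T2 R)
    (Z1 : T -> T1) (Z2 : T -> T2) (F : T1 * T2 -> \bar R) :
  measurable_fun setT Z1 -> measurable_fun setT Z2 ->
  (forall A B, measurable A -> measurable B ->
    P (Z1 @^-1` A `&` Z2 @^-1` B) = (m1 A * m2 B)%E) ->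
  measurable_fun setT F -> (forall z, (0 <= F z)%E) ->
  (\int[P]_w F (Z1 w, Z2 w) = \int[m1]_x \int[m2]_y F (x, y))%E.
Proof.
move=> mZ1 mZ2 ind mF F0; rewrite -fubini_tonelli1//.
have mZ : measurable_fun setT (fun w => (Z1 w, Z2 w)).
  exact: measurable_fun_pair.
have -> : (\int[m1 \x m2]_z F z = \int[pushforward P (fun w => (Z1 w, Z2 w))]_z F z)%E.
  apply: eq_measure_integral => A mA _.
  by apply: product_measure_unique => // B C mB mC; rewrite -ind.
by rewrite ge0_integral_pushforward.
Qed.

(** Fubini under the product law of (U, V): at a fixed value u of U the inner integral is u E[V] =
    0. *)
Lemma integral_indep_mul0 (disp : measure_display) (T : measurableType disp) (R : realType)
    (P : probability T R) (U V : {RV P >-> R}) :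
  (forall A B : set R, measurable A -> measurable B ->
    P (U @^-1` A `&` V @^-1` B) = (P (U @^-1` A) * P (V @^-1` B))%E) ->
  P.-integrable setT (EFin \o V) ->
  P.-integrable setT (fun w => (U w * V w)%:E) ->
  (\int[P]_w (V w)%:E = 0)%E -> (\int[P]_w (U w * V w)%:E = 0)%E.
Proof.
move=> ind iV iUV V0.
pose m1 := distribution P U; pose m2 := distribution P V.
have mZ : measurable_fun setT (fun w => (U w, V w)).
  exact: measurable_fun_pair.
pose F (z : measurableTypeR R * measurableTypeR R) : \bar R := (z.1 * z.2)%:E.
have mF : measurable_fun setT F.
  apply/measurable_EFinP; apply: measurable_funM.
    exact: measurable_fst.
  exact: measurable_snd.
have E A : measurable A -> (m1 \x m2)%E A = pushforward P (fun w => (U w, V w)) A.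
  by move=> mA; apply: product_measure_unique => // B C mB mC; rewrite -ind.
have -> : (\int[P]_w (U w * V w)%:E = \int[m1 \x m2]_z F z)%E.
  transitivity (\int[pushforward P (fun w => (U w, V w))]_z F z)%E.
    by rewrite integral_pushforward.
  by apply: eq_measure_integral => A mA _; exact/esym/E.
have iF : (m1 \x m2)%E.-integrable setT F.
  apply/integrableP; split => //.
  rewrite (eq_measure_integral (pushforward P (fun w => (U w, V w)))); last first.
    by move=> A mA _; exact: E.
  rewrite ge0_integral_pushforward//; last exact: measurableT_comp.
  by have /integrableP[] := iUV.
have iV2 : m2.-integrable setT (EFin : measurableTypeR R -> \bar R).
  apply/integrableP; split => //.
  rewrite ge0_integral_distribution//; last exact: measurableT_comp.
  by have /integrableP[] := iV.
rewrite -integral12_prod_meas1//= -[RHS](@integral0 _ _ _ m1 setT).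
apply: eq_integral => x _; rewrite /fubini_F /F/=.
under eq_integral do rewrite EFinM.
by rewrite integralZl// integral_distribution//= V0 mule0.
Qed.
Section partial_sums.
Context (disp disp' : measure_display) (Omega : measurableType disp)
  (T : measurableType disp') (R : realType) (P : probability Omega R)
  (Z : nat -> {RV P >-> T}) (indZ : mutually_independent Z).

(** The pi-system of cylinder events generating the sigma-algebra of Z_0, ..., Z_(n-1). *)
Let G (n : nat) : set (set Omega) := [set A | exists2 C : nat -> set T,
  forall i, measurable (C i) & A = \bigcap_(i in [set` iota 0 n]) (Z i @^-1` C i)].

Let measurable_preim i (C : set T) : measurable C -> measurable (Z i @^-1` C).
Proof. by move=> mC; rewrite -[X in measurable X]setTI; exact: (measurable_funP (Z i)). Qed.

Let GI n : setI_closed (G n).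
Proof.
move=> _ _ [C mC ->] [D mD ->]; exists (fun i => C i `&` D i).
  by move=> i; exact: measurableI.
by rewrite -bigcapI; apply: eq_bigcapr => i _; rewrite preimage_setI.
Qed.

Let Gm n : G n `<=` measurable.
Proof.
move=> _ [C mC ->]; apply: fin_bigcap_measurable; first exact: finite_seq.
by move=> i _; exact: measurable_preim.
Qed.

Let GP n A D : G n A -> measurable D ->
  P (A `&` Z n @^-1` D) = (P A * P (Z n @^-1` D))%E.
Proof.
move=> [C mC ->] mD.
have := @indZ (n :: iota 0 n) (fun i => if i == n then D else C i).
rewrite /= iota_uniq mem_iota/= add0n ltnn => /(_ isT) H.
rewrite indZ ?iota_uniq//.
have {}H := H (fun i => ltac:(by case: ifP => _; [exact: mD|exact: mC])).
rewrite muleC big_cons eqxx in H *.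
rewrite (_ : _ `&` _ = \bigcap_(i in [set` n :: iota 0 n])
  (Z i @^-1` (if i == n then D else C i))).
  rewrite H; congr (_ * _)%E; apply: eq_big_seq => i.
  by rewrite mem_iota/= add0n => /ltn_eqF ->.
apply/seteqP; split => [w [wC wD] i|w h].
  rewrite /= in_cons mem_iota/= add0n; case: eqVneq => [-> _ //|_/= ii].
  by apply: wC; rewrite /= mem_iota.
split=> [i/=|]; last by have := h n; rewrite /= mem_head eqxx => /(_ isT).
rewrite mem_iota/= add0n => ii; have := h i.
by rewrite /= in_cons mem_iota/= add0n ii orbT (ltn_eqF ii) => /(_ isT).
Qed.

(** The partial sum depends on Z_0, ..., Z_(n-1) only, and independence from Z_n passes from the
    cylinders to the sigma-algebra they generate. *)
Lemma mutually_independent_partial_sum (g : T -> R) (n : nat) (A B : set R) :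
  measurable_fun setT g -> measurable A -> measurable B ->
  P ((fun w => \sum_(i < n) g (Z i w)) @^-1` A `&` (g \o Z n) @^-1` B) =
  (P ((fun w => \sum_(i < n) g (Z i w))%R @^-1` A) * P ((g \o Z n) @^-1` B))%E.
Proof.
move=> mg mA mB.
have mgB : measurable (g @^-1` B) by rewrite -[X in measurable X]setTI; exact: mg.
rewrite [(g \o Z n) @^-1` B]comp_preimage.
apply: (indep_sigma_algebra (@GI n) (@Gm n)) => //; first exact: measurable_preim.
  by move=> C GC; exact: GP.
(* The sum is viewed on [Omega] with the sigma-algebra generated by [G n]: measurability there puts
   the event {S in A} within reach of [indep_sigma_algebra]. *)
pose S : g_sigma_algebraType (G n) -> R := fun w => \sum_(i < n) g (Z i w).
suff mS : measurable_fun setT S by rewrite -[X in <<s _ >> X]setTI; exact: mS.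
apply: measurable_sum => i; apply: (measurableT_comp mg).
move=> _ C mC; rewrite setTI; apply: sub_sigma_algebra.
exists (fun j => if j == i :> nat then C else setT).
  by move=> j; case: ifP.
apply/seteqP; split => [w Cw j _ /=|w /(_ i)].
  by case: ifPn => // /eqP ->.
by rewrite /= mem_iota/= add0n ltn_ord eqxx => /(_ isT).
Qed.

End partial_sums.
(** * Moments of sums of independent variables *)

(* The weight 1/(2n), less than the relative growth of n^(q/2), lets the recursion over
   partial sums close. *)
Lemma normr_powRD_nat (R : realType) (q : R) : 2 <= q -> exists2 c : R, 0 <= c &
  forall (n : nat) (a b : R), (0 < n)%N -> `|a + b| `^ q <=
    (1 + (2 * n%:R)^-1) * `|a| `^ q + q * (`|a| `^ (q - 2) * a * b) +
    c * n%:R `^ ((q - 2) / 2) * `|b| `^ q.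
Proof.
move=> q2; have [c0 c00 H] := normr_powRD2 q2.
have h0 : 0 <= (q - 2) / 2 by lra.
exists (c0 * (2 * c0) `^ ((q - 2) / 2) + c0).
  by rewrite addr_ge0 ?mulr_ge0 ?powR_ge0// ltW.
move=> n a b n0; rewrite (le_trans (H a b))//.
have n0' : 0 < n%:R :> R by rewrite ltr0n.
have n1 : 1 <= n%:R `^ ((q - 2) / 2) :> R by rewrite powR_ge1// ler1n.
have b0 := powR_ge0 `|b| q.
(* With this weight in [powR_split2], the extra multiple of |a|^q is exactly 1/(2n). *)
have l0 : 0 < (2 * c0 * n%:R)^-1 by rewrite invr_gt0 !mulr_gt0.
have := powR_split2 q2 l0 (normr_ge0 a) (normr_ge0 b).
rewrite -[- (_ / 2)]mulN1r [_ `^ (-1 * _)]powRrM powR_inv1 ?invrK ?(ltW l0)//.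
have c20 : 0 <= 2 * c0 by rewrite mulr_ge0// ltW.
rewrite (powRM _ c20)// real_normK ?num_real//.
move=> /(ler_wpM2l (ltW c00)); rewrite mulrDr.
have -> : c0 * ((2 * c0 * n%:R)^-1 * `|a| `^ q) = (2 * n%:R)^-1 * `|a| `^ q.
  by field; rewrite !gt_eqF.
move: n1 => /(ler_wpM2l (ltW c00)) /(ler_wpM2r b0); rewrite mulr1.
lra.
Qed.

(** Supplies the integrability of the linear term |S_n|^(q-2) S_n xi. *)
Lemma normr_powR_mul_le (R : realType) (q a b : R) : 2 <= q ->
  `| `|a| `^ (q - 2) * a * b| <= `|a| `^ q + `|b| `^ q.
Proof.
move=> q2; rewrite !normrM (ger0_norm (powR_ge0 _ _)).
have A0 : 0 <= `|a| `^ (q - 2) by exact: powR_ge0.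
have [ab|/ltW ba] := leP `|a| `|b|.
- apply: ler_wpDl; first exact: powR_ge0.
  rewrite (powR_subr2 q2 (normr_ge0 b)) expr2 mulrA.
  apply: ler_wpM2r => //.
  by apply: ler_pM => //; apply: ge0_ler_powR; rewrite ?nnegrE//; lra.
- apply: ler_wpDr; first exact: powR_ge0.
  by rewrite (powR_subr2 q2 (normr_ge0 a)) expr2 mulrA ler_wpM2l// mulr_ge0.
Qed.

Lemma normr_le_powRD1 (R : realType) (q b : R) : 1 <= q -> `|b| <= 1 + `|b| `^ q.
Proof.
move=> q1; have [b1|/ltW b1] := leP `|b| 1.
  by apply: ler_wpDr => //; exact: powR_ge0.
by apply: ler_wpDl => //; exact: le1r_powR.
Qed.

Section moments_of_sums.
Context (disp disp' : measure_display) (Omega : measurableType disp)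
  (T : measurableType disp') (R : realType) (P : probability Omega R)
  (Z : nat -> {RV P >-> T}) (indZ : mutually_independent Z).

(* With M_n = E|S_n|^q, the term of |S_n + xi|^q linear in xi has mean zero, and
   M_(n+1) <= (1 + 1/(2n)) M_n + c n^(q/2 - 1) s. *)
Lemma moment_sum_independent (g : T -> R) (q s : R) : 2 <= q ->
  measurable_fun setT g ->
  (forall i, \int[P]_w (`|g (Z i w)| `^ q)%:E <= s%:E)%E ->
  (forall i, \int[P]_w (g (Z i w))%:E = 0)%E ->
  exists2 K : R, 0 <= K & forall n, (0 < n)%N ->
    (\int[P]_w (`|\sum_(i < n) g (Z i w)| `^ q)%:E <=
      (K * n%:R `^ (q / 2) * s)%:E)%E.
Proof.
move=> q2 mg hs h0; have [c c0 H] := normr_powRD_nat q2.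
have s0 : 0 <= s.
  by rewrite -lee_fin (le_trans _ (hs 0%N))// integral_ge0// => w _; rewrite lee_fin powR_ge0.
have mgZ i : measurable_fun setT (g \o Z i) by exact: measurableT_comp.
pose S n w := \sum_(i < n) g (Z i w).
have mS n : measurable_fun setT (S n) by apply: measurable_sum => i; exact: mgZ.
have mpow (h : Omega -> R) : measurable_fun setT h ->
    measurable_fun setT (fun w => (`|h w| `^ q)%:E).
  move=> mh; apply/measurable_EFinP.
  by apply: (measurableT_comp (measurable_powR _)); exact: measurableT_comp.
have ipow (h : Omega -> R) (t : R) : measurable_fun setT h ->
    (\int[P]_w (`|h w| `^ q)%:E <= t%:E)%E ->
    P.-integrable setT (fun w => (`|h w| `^ q)%:E).
  move=> mh ht; apply/integrableP; split; first exact: mpow.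
  under eq_integral do rewrite gee0_abs ?lee_fin ?powR_ge0//.
  by rewrite (le_lt_trans ht)// ltry.
(* For K = 1 + 2c the induction closes because c <= K/2. *)
exists (1 + 2 * c); first by lra.
elim=> // -[_ _|n IH _].
  under eq_integral do rewrite big_ord1.
  rewrite powR1 mulr1 (le_trans (hs 0%N))// lee_fin.
  have : 0 <= c * s by exact: mulr_ge0.
  by lra.
move: IH => /(_ isT); set N := n.+1 => IH.
have iS := ipow _ _ (mS N) IH.
have ig := ipow _ _ (mgZ N) (hs N).
pose V : {RV P >-> R} := mfun_Sub (mem_set (mgZ N)).
have mU : measurable_fun setT (fun w => `|S N w| `^ (q - 2) * S N w).
  apply: measurable_funM => //.
  by apply: (measurableT_comp (measurable_powR _)); exact: measurableT_comp.
pose U : {RV P >-> R} := mfun_Sub (mem_set mU).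
have iUV : P.-integrable setT (fun w => (U w * V w)%:E).
  apply: (le_integrable measurableT _ _ (integrableD measurableT iS ig)).
    by apply/measurable_EFinP; exact: measurable_funM.
  move=> w _; rewrite /= lee_fin [leRHS]ger0_norm ?addr_ge0 ?powR_ge0//.
  exact: normr_powR_mul_le.
have UV0 : (\int[P]_w (U w * V w)%:E = 0)%E.
  apply: integral_indep_mul0 => //; last exact: h0.
    move=> A B mA mB.
    (* U is a Borel function of the partial sum, so an event of U is an event {S_N in A'}. *)
    pose A' := (fun x : R => `|x| `^ (q - 2) * x) @^-1` A.
    have mA' : measurable A'.
      rewrite -[A']setTI; apply: (_ : measurable_fun setT _) => //.
      apply: measurable_funM => //.
      by apply: (measurableT_comp (measurable_powR _)).
    exact: (mutually_independent_partial_sum indZ N mg mA' mB).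
  have i1 : P.-integrable setT (EFin \o cst 1) :=
    finite_measure_integrable_cst P 1 measurableT.
  apply: (le_integrable measurableT _ _ (integrableD measurableT i1 ig)).
    exact/measurable_EFinP.
  move=> w _; rewrite /= lee_fin [leRHS]ger0_norm ?addr_ge0 ?powR_ge0//.
  by apply: normr_le_powRD1; lra.
have i1 : P.-integrable setT (fun w => ((1 + (2 * N%:R)^-1)%:E * (`|S N w| `^ q)%:E)%E).
  exact: integrableZl.
have i2 : P.-integrable setT (fun w => (q%:E * (U w * V w)%:E)%E).
  exact: integrableZl.
have i3 : P.-integrable setT
    (fun w => ((c * N%:R `^ ((q - 2) / 2))%:E * (`|g (Z N w)| `^ q)%:E)%E).
  exact: integrableZl.
apply: (@le_trans _ _ (\int[P]_w ((1 + (2 * N%:R)^-1)%:E * (`|S N w| `^ q)%:E +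
    q%:E * (U w * V w)%:E +
    (c * N%:R `^ ((q - 2) / 2))%:E * (`|g (Z N w)| `^ q)%:E))%E).
  apply: ge0_le_integralT => w; first by rewrite lee_fin powR_ge0.
  rewrite big_ord_recr/= -!EFinM -!EFinD lee_fin.
  exact: H.
rewrite integralD//; last exact: integrableD.
rewrite integralD// !integralZl// UV0 mule0 adde0.
have hS := lee_wpmul2l (_ : 0 <= (1 + (2 * N%:R)^-1)%:E)%E IH.
have hG := lee_wpmul2l (_ : 0 <= (c * N%:R `^ ((q - 2) / 2))%:E)%E (hs N).
apply: (le_trans (leeD (hS _) (hG _))).
- by rewrite lee_fin addr_ge0// invr_ge0 mulr_ge0.
- by rewrite lee_fin mulr_ge0// powR_ge0.
rewrite -!EFinM -EFinD lee_fin.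
have e (m : nat) : m.+1%:R `^ (q / 2) = m.+1%:R `^ ((q - 2) / 2) * m.+1%:R :> R.
  rewrite -[X in _ = _ * X]powRr1// -powRD; last by rewrite pnatr_eq0 implybT.
  by congr (_ `^ _); field.
rewrite !e -/N; set x := N%:R `^ _; set y := N.+1%:R `^ _.
have x0 : 0 <= x by exact: powR_ge0.
have xy : x <= y by apply: ge0_ler_powR; rewrite ?nnegrE ?ler_nat//; lra.
have N0 : 0 < N%:R :> R by rewrite ltr0n.
(* Replacing [y] by the smaller [x] leaves the common factor x s and the linear inequality K N + K/2
   + c <= K (N + 1). *)
apply: (@le_trans _ _ ((1 + 2 * c) * (x * N.+1%:R) * s)); last first.
  by rewrite ler_wpM2r// ler_wpM2l ?ler_wpM2r//; lra.
rewrite [leLHS](_ : _ = (x * s) * ((1 + 2 * c) * N%:R + (1 + 2 * c) / 2 + c)); last first.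
  by field; rewrite gt_eqF.
rewrite [leRHS](_ : _ = (x * s) * ((1 + 2 * c) * N.+1%:R)); last by ring.
rewrite ler_wpM2l ?mulr_ge0// -[N.+1]addn1 natrD.
by lra.
Qed.

End moments_of_sums.

(** * Nearest neighbours *)

Section nearest_neighbours.
Context (R : realType) (d : nat) (nrm : 'rV[R]_d -> R) (x' : nat -> 'rV[R]_d)
  (x : 'rV[R]_d).

Let D i := nrm (x - x' i).

Let closer_total : total (closer nrm x' x).
Proof.
move=> i j; rewrite /closer -!/(D _) [D j == _]eq_sym.
by have [] //= := ltgtP (D i) (D j) => _; exact: leq_total.
Qed.

Let closer_trans : transitive (closer nrm x' x).
Proof.
move=> j i l /orP[ij|/andP[/eqP ij iej]] /orP[jl|/andP[/eqP jl jel]]; apply/orP.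
- by left; exact: lt_trans jl.
- by left; rewrite -jl.
- by left; rewrite ij.
- by right; rewrite ij jl eqxx (leq_trans iej).
Qed.

Let closer_le i j : closer nrm x' x i j -> D i <= D j.
Proof. by move=> /orP[/ltW //|/andP[/eqP ij _]]; rewrite /D ij. Qed.

Lemma nn_index_lt (m l : nat) : (l < m)%N -> (nn_index nrm m x' x l < m)%N.
Proof.
move=> lm; rewrite /nn_index.
have : nth m (sort (closer nrm x' x) (iota 0 m)) l \in iota 0 m.
  by rewrite -(mem_sort (closer nrm x' x)) mem_nth// size_sort size_iota.
by rewrite mem_iota.
Qed.

(** Strictly closer points precede the given neighbour in the sorted list, and only l positions do;
    indices start at 0, so l = 0 is the nearest point. *)
Lemma count_closer_nn_index (m l : nat) : (l < m)%N ->
  (\sum_(0 <= i < m) (D i < D (nn_index nrm m x' x l))%R <= l)%N.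
Proof.
move=> lm; set s := sort (closer nrm x' x) (iota 0 m).
rewrite /index_iota subn0.
have -> : (\sum_(i <- iota 0 m) (D i < D (nn_index nrm m x' x l))%R =
    count (fun i => D i < D (nth m s l))%R s)%N.
  rewrite -sum1_count [RHS](perm_big (iota 0 m)) ?perm_sort//= [RHS]big_mkcond/=.
  by apply: eq_bigr => i _; rewrite /nn_index -/s; case: (_ < _).
have sz : size s = m by rewrite size_sort size_iota.
rewrite -{2}(cat_take_drop l s) count_cat.
have -> : count (fun i => D i < D (nth m s l)) (drop l s) = 0%N.
  apply/eqP; rewrite -leqn0 leqNgt -has_count; apply/hasPn => i /(nthP m)[j].
  rewrite size_drop sz => jm <-; rewrite nth_drop -leNgt; apply: closer_le.
  apply: (@sorted_leq_nth _ (closer nrm x' x)) => //.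
  - by move=> i0; rewrite /closer eqxx leqnn orbT.
  - exact: sort_sorted.
  - by rewrite inE sz.
  - by rewrite inE sz -ltn_subRL.
  - exact: leq_addr.
by rewrite addn0 (leq_trans (count_size _ _))// size_take sz lm.
Qed.

End nearest_neighbours.

(* The minimum of D over the block b * M, ..., b * M + M - 1; for M = 0 it is the
   junk value D 0. *)
Definition blockmin (R : realType) (D : nat -> R) (M b : nat) : R :=
  \big[Num.min/D (b * M)%N]_(j < M) D (b * M + j)%N.

Lemma lt_blockminP (R : realType) (D : nat -> R) (M b : nat) (r : R) : (0 < M)%N ->
  reflect (forall j, (j < M)%N -> r < D (b * M + j)%N) (r < blockmin D M b).
Proof.
move=> M0; apply: (iffP (bigmin_gtP _ _ _ _)) => [[_ h] j jM|h].
  exact: (h (Ordinal jM)).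
by split=> [|j _]; [have := h _ M0; rewrite addn0|exact: h].
Qed.

Lemma blockmin_ge0 (R : realType) (D : nat -> R) (M b : nat) :
  (forall i, 0 <= D i) -> 0 <= blockmin D M b.
Proof. by move=> D0; apply/bigmin_geP; split. Qed.

(** The blocks are disjoint, so at most l < k of them have a minimum below t; each of the remaining
    blocks, at least k in number, contributes at least t^q. *)
Lemma blockmin_powR_sum (R : realType) (D : nat -> R) (q t : R) (M k m l : nat) :
  0 <= q -> (forall i, 0 <= D i) -> 0 <= t -> (0 < M)%N -> (2 * k * M <= m)%N -> (l < k)%N ->
  (\sum_(0 <= i < m) (D i < t)%R <= l)%N ->
  k%:R * t `^ q <= \sum_(b < 2 * k) blockmin D M b `^ q.
Proof.
move=> q0 D0 t0 M0 km lk cl.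
have bad : (\sum_(b < 2 * k) (blockmin D M b < t)%R <= l)%N.
  apply: leq_trans cl; rewrite (big_cat_nat _ km)//=.
  apply: leq_trans (leq_addr _ _); rewrite big_nat_mul big_mkord.
  apply: leq_sum => b _.
  case: ltP => // bt; rewrite lt0n; apply/eqP => s0.
  move: bt; apply/negP; rewrite -leNgt; apply/bigmin_geP.
  have H j : (j < M)%N -> t <= D (b * M + j)%N.
    move=> jM; rewrite leNgt; apply/negP => Dt.
    have : (0 < \sum_(b * M <= i < b.+1 * M) (D i < t)%R)%N.
      rewrite (big_cat_nat (n := (b * M + j)%N)) ?leq_addr//=; last first.
        by rewrite [(b.+1 * M)%N]mulSnr leq_add2l ltnW.
      rewrite [X in (_ + X)%N]big_ltn; last by rewrite [(b.+1 * M)%N]mulSnr ltn_add2l.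
      by rewrite Dt addnCA.
    by rewrite s0.
  by split=> [|j _]; [have := H _ M0; rewrite addn0|exact: H].
apply: (@le_trans _ R (\sum_(b < 2 * k) (1 - (blockmin D M b < t)%R%:R) * t `^ q)%R).
  rewrite -mulr_suml ler_wpM2r ?powR_ge0// big_split/= sumr_const card_ord.
  rewrite sumrN -natr_sum.
  rewrite [X in X%:R - _](_ : _ = k + k)%N; last by rewrite mul2n addnn.
  rewrite natrD -addrA lerDl.
  by rewrite subr_ge0 ler_nat (leq_trans bad)// ltnW.
apply: ler_sum => b _; case: ltP => bt; first by rewrite subrr mul0r powR_ge0.
rewrite subr0 mul1r; apply: ge0_ler_powR; rewrite ?nnegrE//; exact: blockmin_ge0.
Qed.

(* Here u x r stands for mu_X'(B(x, r)), h t for P(|X'| > t) and nx x for |x|. *)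
Section nearest_neighbour_tail.
Context (R : realType) (T : Type) (U : set T) (p nx : T -> R)
  (u : T -> R -> R) (h : R -> R) (s c rk pmax Cm : R) (d m0 : nat).
Hypotheses (s0 : 0 < s) (d0 : (0 < d)%N) (c0 : 0 < c) (rk0 : 0 < rk)
  (m00 : (0 < m0)%N) (Cm0 : 0 < Cm).
Hypothesis u01 : forall x (r : R), 0 <= u x r <= 1.
Hypothesis u_nd : forall x (r r' : R), r <= r' -> u x r <= u x r'.
Hypothesis p0 : forall x, U x -> 0 < p x <= pmax.
Hypothesis nx0 : forall x, 0 <= nx x.
Hypothesis u_lb : forall x (r : R), U x -> 0 <= r -> r <= rk -> c * p x * r ^+ d <= u x r.
Hypothesis h01 : forall t : R, 0 <= h t <= 1.
Hypothesis h_tail : forall t : R, 0 < t -> h t ^+ m0 <= Cm / t.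
Hypothesis u_h : forall x (t r : R), t + nx x <= r -> 1 - u x r <= h t.

Let a : R := s / d%:R.

Let a0 : 0 < a. Proof. by rewrite divr_gt0// ltr0n. Qed.

(** Write r^s = (r^d)^a. The lower bound on u gives M p(x) r^d <= M u / c, and [powR_expr_bound]
    absorbs (M u)^a into (1 - u)^M. *)
Let small_radius x M (r : R) : U x -> 0 < r -> r <= rk ->
  (1 - u x r) ^+ M * (M%:R * p x) `^ a * r `^ s <= (a / c) `^ a.
Proof.
move=> Ux r0 rrk; have /andP[px0 _] := p0 Ux.
have /andP[ux0 ux1] := u01 x r; have s0' := ltW s0.
have y0 : 0 <= (1 - u x r) ^+ M by rewrite exprn_ge0// subr_ge0.
have Mp0 : 0 <= M%:R * p x by rewrite mulr_ge0// ltW.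
have -> : r `^ s = (r ^+ d) `^ a.
  rewrite -powR_mulrn ?(ltW r0)// -powRrM; congr (_ `^ _).
  by rewrite /a mulrC divfK// pnatr_eq0 -lt0n.
have rd0 : 0 <= r ^+ d by rewrite exprn_ge0// ltW.
rewrite -mulrA -powRM//.
have H := powR_expr_bound M a0 (u01 x r).
rewrite -(ler_pM2l (powR_gt0 a c0)) -[leRHS]powRM ?(ltW c0) ?divr_ge0 ?(ltW a0)//; last exact: ltW.
rewrite [c * (a / c)]mulrC divfK ?gt_eqF//.
apply: le_trans H; rewrite mulrCA mulrC; apply: ler_wpM2r => //.
rewrite -powRM ?(ltW c0) ?mulr_ge0//; last exact: ltW.
apply: ge0_ler_powR; rewrite ?nnegrE ?(ltW a0) ?mulr_ge0 ?(ltW c0) ?(ltW px0)//.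
have := u_lb Ux (ltW r0) rrk => /(ler_wpM2l (ler0n R M)); apply: le_trans.
by rewrite le_eqVlt; apply/orP; left; apply/eqP; ring.
Qed.

Lemma nearest_neighbour_tail : exists (K : R) (M0 : nat),
  [/\ 0 <= K, (0 < M0)%N & forall x M (r : R), U x -> (M0 <= M)%N -> 0 < r ->
  (1 - u x r) ^+ M * (M%:R * p x) `^ (s / d%:R) * r `^ s <= K * (1 + nx x) `^ s].
Proof.
(* A is an integer above s: A groups of m0 factors of h will produce the decay r^(-s). *)
pose A := (Num.trunc s).+1.
have sA : s <= A%:R by rewrite ltW// truncnS_gt.
(* For r >= t0 (1 + |x|), the 2 allows the choice t = r/2 in [u_h], and the second term gives h(r/2)
   <= 1/2 and 2 Cm / r <= 1. *)
pose t0 : R := 2 + 2 ^+ m0.+1 * Cm.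
have t02 : 2 <= t0 by rewrite lerDl mulr_ge0// ?exprn_ge0// ltW.
pose K1 := (a / c) `^ a.
pose K2 := K1 * (t0 / rk) `^ s.
pose K3 := (4 * a * pmax) `^ a * (2 * Cm) `^ s.
have K10 : 0 <= K1 by exact: powR_ge0.
have K20 : 0 <= K2 by rewrite mulr_ge0// powR_ge0.
have K30 : 0 <= K3 by rewrite mulr_ge0// powR_ge0.
(* One constant per range of r. From this M on, at least M/2 factors remain once m0 A have been
   spent. *)
exists (K1 + K2 + K3), (2 * (m0 * A))%N; split.
- by rewrite !addr_ge0.
- by rewrite !muln_gt0/= m00.
move=> x M r Ux MM r0; rewrite -/a.
have nx1 : 1 <= (1 + nx x) `^ s by rewrite powR_ge1 ?(ltW s0)// lerDl.
have nx1' : 0 <= 1 + nx x by rewrite addr_ge0.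
have /andP[px0 pxm] := p0 Ux.
have /andP[ux0 ux1] := u01 x r.
have [rrk|rkr] := leP r rk.
  rewrite (le_trans (small_radius M Ux r0 rrk))// -/K1.
  by rewrite (@le_trans _ _ ((K1 + K2 + K3) * 1)) ?ler_wpM2l ?addr_ge0//; lra.
(* Middle range: u(x, r) >= u(x, rk), and replacing rk by r costs the factor (r / rk)^s, at most (t0
   / rk)^s (1 + |x|)^s. *)
have [rT|Tr] := leP r (t0 * (1 + nx x)).
  apply: (@le_trans _ _ (K2 * (1 + nx x) `^ s)); last first.
    by rewrite ler_wpM2r ?powR_ge0//; lra.
  have := small_radius M Ux rk0 (lexx _); rewrite -/K1.
  move=> /(ler_wpM2r (powR_ge0 (r / rk) s)).
  rewrite -!mulrA -(powRM _ (ltW rk0)) ?divr_ge0 ?(ltW rk0) ?(ltW r0)//.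
  rewrite [rk * _]mulrC divfK ?gt_eqF// => H.
  apply: (le_trans (_ : _ <= (1 - u x rk) ^+ M * ((M%:R * p x) `^ a * r `^ s))).
    apply: ler_wpM2r; first by rewrite mulr_ge0 ?powR_ge0.
    apply: lerXn2r; rewrite ?nnegrE ?subr_ge0//.
      by have /andP[] := u01 x rk.
    by rewrite lerB// u_nd// ltW.
  apply: (le_trans H); apply: ler_wpM2l => //.
  have t00 : 0 <= t0 / rk by rewrite divr_ge0 ?(ltW rk0)//; lra.
  rewrite -powRM//.
  apply: ge0_ler_powR; rewrite ?nnegrE; [exact: ltW| |exact: mulr_ge0|].
    by rewrite divr_ge0 ?(ltW r0) ?(ltW rk0).
  by rewrite mulrAC ler_wpM2r// invr_ge0 ltW.
(* Far range: 1 - u(x, r) <= y = h(r/2), whose M factors are split into m0 A, which give decay in r,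
   and [M'], which give decay in M. *)
apply: (@le_trans _ _ (K3 * 1)); last first.
  rewrite (@le_trans _ _ ((K1 + K2 + K3) * 1))//; first lra.
  by rewrite ler_wpM2l ?addr_ge0.
rewrite mulr1; set y := h (r / 2); have /andP[y0 y1] := h01 (r / 2).
have rt0 : t0 <= r.
  by rewrite (le_trans _ (ltW Tr))// ler_peMr ?lerDl//; lra.
have uy : 1 - u x r <= y.
  apply: u_h; have : 2 * (1 + nx x) <= t0 * (1 + nx x) by rewrite ler_wpM2r.
  by move: (t0 * _) Tr => z; lra.
have yr : y ^+ m0 <= 2 * Cm / r.
  have := @h_tail (r / 2); rewrite divr_gt0// => /(_ isT); rewrite -/y.
  by rewrite invf_div mulrA [Cm * 2]mulrC.
have y2 : y <= 2^-1.
  rewrite -(@ler_pXn2r _ m0) ?nnegrE ?invr_ge0// (le_trans yr)//.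
  rewrite exprVn ler_pdivrMr// ler_pdivlMl ?exprn_gt0//.
  by apply: le_trans rt0; rewrite /t0 exprS; move: (2 ^+ m0) => z; lra.
have Cr1 : 2 * Cm / r <= 1.
  rewrite ler_pdivrMr// mul1r; apply: le_trans rt0.
  rewrite /t0 (@le_trans _ _ (2 ^+ m0.+1 * Cm))//; last lra.
  by rewrite ler_wpM2r ?(ltW Cm0)// exprS ler_peMr// exprn_ege1// ler1n.
have Cr0 : 0 < 2 * Cm / r by rewrite divr_gt0// mulr_gt0.
pose M' := (M - m0 * A)%N.
have mM : (m0 * A <= M)%N by rewrite (leq_trans _ MM)// leq_pmull.
have M'M : (M <= 2 * M')%N.
  by rewrite -{1}(subnK mM) mul2n -addnn leq_add2l leq_subRL// addnn -mul2n.
have step1 : y ^+ (m0 * A) <= (2 * Cm / r) `^ s.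
  rewrite exprM (@le_trans _ _ ((2 * Cm / r) ^+ A))//.
    by apply: lerXn2r; rewrite ?nnegrE ?exprn_ge0 ?(ltW Cr0).
  by rewrite -powR_mulrn ?(ltW Cr0)//; apply: ger_powR => //; rewrite Cr0.
(* Since y <= 1/2 and M <= 2 M', the quantity M/4 is at most M' (1 - y), to which [powR_expr_bound]
   applies. *)
have step2 : (M%:R / 4) `^ a * y ^+ M' <= a `^ a.
  have := @powR_expr_bound R a (1 - y) M' a0.
  rewrite subKr => H; apply: le_trans (H _); last by lra.
  apply: ler_wpM2r; first exact: exprn_ge0.
  apply: ge0_ler_powR; rewrite ?nnegrE ?(ltW a0) ?divr_ge0 ?mulr_ge0 ?subr_ge0//.
  have : (M%:R : R) <= 2 * M'%:R by rewrite -natrM ler_nat.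
  have : (0 : R) <= M'%:R by [].
  by move: (M%:R : R) (M'%:R : R) => z w; nra.
have -> : K3 = (a `^ a * (4 * pmax) `^ a) * ((2 * Cm / r) `^ s * r `^ s).
  have pm0 : 0 <= pmax by rewrite (le_trans (ltW px0)).
  rewrite -[X in _ = _ * X]powRM ?(ltW r0) ?(ltW Cr0)//.
  rewrite -[X in _ = X * _]powRM ?(ltW a0) ?mulr_ge0// divfK ?gt_eqF//.
  by rewrite /K3; congr (_ `^ _ * _); ring.
have -> : M%:R * p x = M%:R / 4 * (4 * p x) by field.
rewrite (_ : (M%:R / 4 * (4 * p x)) `^ a = (M%:R / 4) `^ a * (4 * p x) `^ a); last first.
  by apply: powRM; [exact: divr_ge0|rewrite mulr_ge0// ltW].
apply: (@le_trans _ _ (y ^+ M * ((M%:R / 4) `^ a * (4 * p x) `^ a) * r `^ s)).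
  rewrite ler_wpM2r ?powR_ge0// ler_wpM2r ?mulr_ge0 ?powR_ge0//.
  by apply: lerXn2r; rewrite ?nnegrE ?subr_ge0.
have -> : y ^+ M = y ^+ (m0 * A) * y ^+ M' by rewrite -exprD subnKC.
rewrite [leLHS](_ : _ = ((M%:R / 4) `^ a * y ^+ M' * (4 * p x) `^ a) *
  (y ^+ (m0 * A) * r `^ s)); last by ring.
apply: ler_pM; rewrite ?mulr_ge0 ?powR_ge0 ?exprn_ge0//; last first.
  by rewrite ler_wpM2r ?powR_ge0.
apply: ler_pM; rewrite ?mulr_ge0 ?powR_ge0 ?exprn_ge0//.
apply: ge0_ler_powR; rewrite ?nnegrE ?(ltW a0) ?mulr_ge0 ?(ltW px0)//.
  by rewrite (le_trans (ltW px0)).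
by rewrite ler_wpM2l.
Qed.

End nearest_neighbour_tail.

(* Dyadic layers: N^q <= s^q + sum_l (2^(l+1) s)^q 1{N > 2^l s}. *)
Lemma moment_of_tail (disp : measure_display) (T : measurableType disp) (R : realType)
    (P : probability T R) (N : T -> R) (q s K : R) :
  measurable_fun setT N -> (forall w, 0 <= N w) -> 0 < q -> 0 < s -> 0 <= K ->
  (forall r : R, 0 < r -> (P [set w | r < N w]%R <= (K * (s / r) `^ (q + 1))%:E)%E) ->
  (\int[P]_w (N w `^ q)%:E <= ((1 + K * 2 `^ (q + 1)) * s `^ q)%:E)%E.
Proof.
move=> mN N0 q0 s0 K0 tail.
pose E (l : nat) := [set w | 2 ^+ l * s < N w].
have mE l : measurable (E l).
  rewrite (_ : E l = N @^-1` `]2 ^+ l * s, +oo[%classic).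
    by rewrite -[X in measurable X]setTI; exact: mN.
  by apply/seteqP; split => w /=; rewrite in_itv/= andbT.
pose g l w : \bar R := (((2 ^+ l.+1 * s) `^ q)%:E * (\1_(E l) w)%:E)%E.
have g0 l w : (0 <= g l w)%E by rewrite mule_ge0// lee_fin// powR_ge0.
have mg l : measurable_fun setT (g l).
  by apply: measurable_funeM; apply/measurable_EFinP; exact: measurable_indic.
have ms : measurable_fun setT (fun w => \sum_(l <oo) g l w)%E.
  by apply: ge0_emeasurable_sum => // *; exact: g0.
apply: (@le_trans _ _ (\int[P]_w ((s `^ q)%:E + \sum_(l <oo) g l w))%E).
  apply: ge0_le_integralT => w; first by rewrite lee_fin powR_ge0.
  have S0 : (0 <= \sum_(l <oo) g l w)%E by apply: nneseries_ge0 => *; exact: g0.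
  have [Ns|sN] := leP (N w) s.
    apply: le_trans (leeDl _ S0).
    by rewrite lee_fin; apply: ge0_ler_powR; rewrite ?nnegrE ?(ltW q0) ?(ltW s0).
  (* The least such exponent is not 0, since N > s. Writing it l + 1, minimality gives 2^l s < N <=
     2^(l+1) s, so layer l alone dominates N^q. *)
  have ex : exists l, N w <= 2 ^+ l * s.
    exists (Num.bound (N w / s)); rewrite -ler_pdivrMr//.
    rewrite (le_trans (ltW (archi_boundP _)))//; first by rewrite divr_ge0// ltW.
    by rewrite -natrX ler_nat ltnW// ltn_expl.
  case: (ex_minnP ex) => -[|l Nl lmin].
    by rewrite expr0 mul1r leNgt sN.
  have Nl' : 2 ^+ l * s < N w.
    by rewrite ltNge; apply/negP => /lmin; rewrite ltnn.
  apply: (@le_trans _ _ (g l w)).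
    rewrite /g indicE mem_set// mule1 lee_fin.
    by apply: ge0_ler_powR; rewrite ?nnegrE ?(ltW q0) ?mulr_ge0 ?(ltW s0).
  apply: (@le_trans _ _ (\sum_(l <oo) g l w)%E); last first.
    by rewrite addeC leeDl// lee_fin powR_ge0.
  apply: (@le_trans _ _ (\sum_(0 <= i < l.+1) g i w)%E).
    by rewrite big_nat_recr//= addeC leeDl// sume_ge0// => i _; exact: g0.
  by apply: nneseries_lim_ge => *; exact: g0.
rewrite ge0_integralD//; last 2 first.
- by move=> w _; rewrite lee_fin powR_ge0.
- by move=> w _; apply: nneseries_ge0 => *; exact: g0.
have -> : (\int[P]__ (s `^ q)%:E = (s `^ q)%:E)%E.
  by have := expectation_cst P (s `^ q); rewrite unlock.
rewrite integral_nneseries//.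
rewrite mulrDl mul1r EFinD leeD2l//.
(* Layer l contributes at most (2^(l+1) s)^q K 2^(-l(q+1)) = K 2^(q+1) s^q / 2^(l+1), a geometric
   series; the tail exponent q + 1 is what makes it summable. *)
have := @epsilon_trick0 R (K * 2 `^ (q + 1) * s `^ q) xpredT.
rewrite !mulr_ge0 ?powR_ge0// => /(_ isT); apply: le_trans.
apply: lee_nneseries => [l _ _|l _].
  by rewrite integral_ge0.
rewrite ge0_integralZl_EFin ?powR_ge0//; last first.
- by apply/measurable_EFinP; exact: measurable_indic.
rewrite integral_indic// setIT.
have z0 : 0 < 2 ^+ l :> R by rewrite exprn_gt0.
apply: (@le_trans _ _ (((2 ^+ l.+1 * s) `^ q)%:E * (K * (s / (2 ^+ l * s)) `^ (q + 1))%:E)%E).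
  apply: lee_wpmul2l; first by rewrite lee_fin powR_ge0.
  by apply: tail; rewrite mulr_gt0.
rewrite -EFinM lee_fin natrX exprS.
rewrite (_ : s / (2 ^+ l * s) = (2 ^+ l)^-1); last by field; rewrite !gt_eqF.
move: (2 ^+ l : R) z0 => z z0.
have zi : 0 < z^-1 by rewrite invr_gt0.
rewrite -mulrA [(2 * _) `^ q]powRM ?mulr_ge0 ?(ltW z0) ?(ltW s0)//.
rewrite powRM ?(ltW z0) ?(ltW s0)//.
have D1 (y : R) : 0 < y -> y `^ (q + 1) = y `^ q * y.
  by move=> y0; rewrite powRD ?powRr1 ?(ltW y0)// (gt_eqF y0) implybT.
rewrite !D1//.
have zz : z `^ q * z^-1 `^ q = 1.
  by rewrite -powRM ?(ltW z0) ?(ltW zi)// divff ?gt_eqF// powR1.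
rewrite [leLHS](_ : _ = (z `^ q * z^-1 `^ q) * (K * (2 `^ q * s `^ q) * z^-1)); last by ring.
rewrite zz mul1r le_eqVlt; apply/orP; left; apply/eqP; field.
by rewrite gt_eqF.
Qed.

Lemma measurable_blockmin (disp : measure_display) (T : measurableType disp)
    (R : realType) (D : nat -> T -> R) (M b : nat) :
  (forall i, measurable_fun setT (D i)) ->
  measurable_fun setT (fun t => blockmin (D ^~ t) M b).
Proof.
move=> mD; rewrite /blockmin; elim: (index_enum _) => [|j s IH].
  by under eq_fun do rewrite big_nil; exact: mD.
under eq_fun do rewrite big_cons.
exact: measurable_minr.
Qed.

Lemma iid_block (disp disp' : measure_display) (Omega : measurableType disp)
    (T : measurableType disp') (R : realType) (P : probability Omega R)
    (Z : nat -> {RV P >-> T}) (mu : probability T R) (B : set T) (i M : nat) :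
  iid Z mu -> measurable B ->
  P (\bigcap_(j in [set` iota i M]) (Z j @^-1` B)) = ((fine (mu B)) ^+ M)%:E.
Proof.
move=> [indZ lawZ] mB; rewrite (indZ _ (fun=> B)) ?iota_uniq//.
rewrite (eq_bigr (fun=> (fine (mu B))%:E)); last first.
  by move=> j _; rewrite fineK ?fin_num_measure// -(lawZ j).
elim: M i => [|M IH] i; first by rewrite /= big_nil expr0.
by rewrite /= big_cons IH exprS EFinM.
Qed.

Lemma nball_subset (R : realType) (d : nat) (nrm : 'rV[R]_d -> R) (x : 'rV[R]_d) (t r : R) :
  is_norm nrm -> t + nrm x <= r -> nball nrm 0 t `<=` nball nrm x r.
Proof.
move=> hn tr y; rewrite /nball/= sub0r is_normN// => yt.
have := is_norm_triangle hn x (- y); rewrite is_normN//; lra.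
Qed.

Lemma powR_addr_le (R : realType) (q a b : R) : 0 <= q -> 0 <= a -> 0 <= b ->
  (a + b) `^ q <= 2 `^ q * (a `^ q + b `^ q).
Proof.
move=> q0 a0 b0; have [ab|/ltW ba] := leP a b.
- apply: (@le_trans _ _ (2 `^ q * b `^ q)); last first.
    by rewrite ler_wpM2l ?powR_ge0// lerDr powR_ge0.
  by rewrite -powRM//; apply: ge0_ler_powR; rewrite ?nnegrE ?addr_ge0 ?mulr_ge0//; lra.
- apply: (@le_trans _ _ (2 `^ q * a `^ q)); last first.
    by rewrite ler_wpM2l ?powR_ge0// lerDl powR_ge0.
  by rewrite -powRM//; apply: ge0_ler_powR; rewrite ?nnegrE ?addr_ge0 ?mulr_ge0//; lra.
Qed.

Section nearest_neighbour_moment.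
Context (R : realType) (d : nat) (nrm : 'rV[R]_d -> R) (muX' : probability 'rV[R]_d R)
  (disp : measure_display) (Omega : measurableType disp) (P : probability Omega R)
  (X' : nat -> {RV P >-> 'rV[R]_d}) (U : set 'rV[R]_d) (p : 'rV[R]_d -> R).
Hypotheses (hd : (0 < d)%N) (hn : is_norm nrm) (hX' : iid X' muX')
  (ha : exists m0 : nat, (0 < m0)%N /\
    (\int[P]_w (\big[mine/+oo]_(j < m0) (nrm (X' j w))%:E) < +oo)%E)
  (U0 : U !=set0) (pU : forall x, U x -> 0 < p x)
  (hb : exists kappa rk : R, [/\ 0 < kappa, kappa <= 1, 0 < rk &
      forall (x : 'rV[R]_d) (r : R), U x -> 0 <= r -> r <= rk ->
        (kappa%:E * (p x)%:E * unit_ball_volume nrm * (r ^+ d)%:E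
          <= muX' (nball nrm x r))%E]).

(** Condition (iii) turned into an inequality between reals. The unit ball volume is finite, since
    otherwise (iii) at a point of U with r = rk would give a ball infinite mass. *)
Lemma ball_lower_bound : exists c rk : R, [/\ 0 < c, 0 < rk &
  forall (x : 'rV[R]_d) (r : R), U x -> 0 <= r -> r <= rk ->
    c * p x * r ^+ d <= fine (muX' (nball nrm x r))].
Proof.
have [kappa [rk [k0 k1 rk0 H]]] := hb; have v0 := unit_ball_volume_gt0 hn.
have fin x r : muX' (nball nrm x r) \is a fin_num.
  by apply: fin_num_measure; exact: measurable_nball.
have vfin : unit_ball_volume nrm \is a fin_num.
  rewrite gt0_fin_numE// ltNge leye_eq; apply/negP => /eqP voo.
  have [x Ux] := U0; have := H x rk Ux (ltW rk0) (lexx _).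
  rewrite voo -EFinM gt0_muley ?lte_fin ?mulr_gt0 ?pU// gt0_mulye ?lte_fin ?exprn_gt0//.
  by rewrite leye_eq => /eqP yE; have := fin x rk; rewrite yE.
exists (kappa * fine (unit_ball_volume nrm)), rk; split => //.
  by rewrite mulr_gt0// fine_gt0// v0 ltey_eq vfin.
move=> x r Ux r0 rrk; have := H x r Ux r0 rrk.
rewrite -(fineK vfin) -(fineK (fin x r)) -!EFinM lee_fin; apply: le_trans.
by rewrite /= [kappa * _ * p x]mulrAC.
Qed.

Lemma density_bounded : exists pmax : R, forall x, U x -> p x <= pmax.
Proof.
have [c [rk [c0 rk0 H]]] := ball_lower_bound.
exists (c * rk ^+ d)^-1 => x Ux.
have := H x rk Ux (ltW rk0) (lexx _).
have : fine (muX' (nball nrm x rk)) <= 1.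
  rewrite -lee_fin fineK ?fin_num_measure ?probability_le1//; exact: measurable_nball.
move=> h1 /le_trans/(_ h1); rewrite mulrAC => h2.
by rewrite -[leRHS]mul1r ler_pdivlMr ?mulr_gt0 ?exprn_gt0// mulrC.
Qed.

(** Markov's inequality for the minimum in (a): by independence, the event that all m0 points lie
    outside B(0, t) has the m0-th power as its probability. The 1 added to the expectation makes the
    constant strictly positive. *)
Lemma sample_tail : exists (m0 : nat) (C : R), [/\ (0 < m0)%N, 0 < C &
  forall t : R, 0 < t -> fine (muX' (~` nball nrm 0 t)) ^+ m0 <= C / t].
Proof.
have [m0 [m00 fin]] := ha.
set E := (\int[P]_w _)%E in fin.
have E0 : (0 <= E)%E.
  apply: integral_ge0 => w _; apply/bigmin_geP; split => //= i _.
  by rewrite lee_fin is_norm_ge0.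
have Efin : E \is a fin_num by rewrite ge0_fin_numE.
exists m0, (fine E + 1); split => //; first by rewrite ltr_wpDl ?fine_ge0.
move=> t t0; rewrite ler_pdivlMr//.
apply: (@le_trans _ _ (fine E)); last by rewrite lerDl.
have mB : measurable (~` nball nrm 0 t) by apply: measurableC; exact: measurable_nball.
rewrite -lee_fin fineK// EFinM -(iid_block 0 m0 hX' mB).
set A := \bigcap_(_ in _) _.
have mA : measurable A.
  apply: fin_bigcap_measurable; first exact: finite_seq.
  by move=> i _; rewrite -[X in measurable X]setTI; exact: (measurable_funP (X' i)).
rewrite muleC -[A]setIT -integral_indic// -ge0_integralZl_EFin ?(ltW t0)//; last first.
  by apply/measurable_EFinP; exact: measurable_indic.
apply: ge0_le_integralT => w; first by rewrite mule_ge0// lee_fin// ltW.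
rewrite indicE; case: (boolP (w \in A)) => [|_]; last first.
  rewrite mule0; apply/bigmin_geP; split => //= i _.
  by rewrite lee_fin is_norm_ge0.
rewrite inE mule1 => Aw; apply/bigmin_geP; split; first by rewrite leey.
move=> /= i _; rewrite lee_fin.
have /= := Aw i; rewrite mem_iota/= ltn_ord => /(_ isT).
by rewrite /nball/= sub0r is_normN// => /negP; rewrite -ltNge => /ltW.
Qed.

Lemma nearest_neighbour_moment (q : R) : 0 < q -> exists (K : R) (M0 : nat),
  [/\ 0 <= K, (0 < M0)%N & forall x (M b : nat), U x -> (M0 <= M)%N ->
    (\int[P]_w (blockmin (fun j => nrm (x - X' j w)) M b `^ q)%:E <=
      (K * M%:R `^ (- (q / d%:R)) * ((1 + nrm x `^ q) / p x `^ (q / d%:R)))%:E)%E].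
Proof.
move=> q0; have [c [rk [c0 rk0 hlb]]] := ball_lower_bound.
have [pmax hpm] := density_bounded; have [m0 [Cm [m00 Cm0 htail]]] := sample_tail.
have mB x (r : R) : measurable (nball nrm x r) by exact: measurable_nball.
have fin (B : set 'rV[R]_d) : measurable B -> muX' B \is a fin_num.
  by move=> ?; exact: fin_num_measure.
have le1 (B : set 'rV[R]_d) : measurable B -> 0 <= fine (muX' B) <= 1.
  move=> mb; rewrite fine_ge0//= -lee_fin fineK ?fin//.
  exact: probability_le1.
have fineC (B : set 'rV[R]_d) : measurable B -> fine (muX' (~` B)) = 1 - fine (muX' B).
  move=> mb; rewrite probability_setC// fineB ?fin//.
have mono (B C : set 'rV[R]_d) : measurable B -> measurable C -> B `<=` C ->
    fine (muX' B) <= fine (muX' C).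
  by move=> mb mc BC; apply: fine_le; rewrite ?fin//; apply: le_measure; rewrite ?inE.
have q10 : 0 < q + 1 by rewrite addr_gt0.
(* The tail is taken with exponent q + 1, as [moment_of_tail] requires. *)
have [K [M0 [K0 M00 HK]]] := @nearest_neighbour_tail R 'rV[R]_d U p nrm
  (fun x r => fine (muX' (nball nrm x r))) (fun t => fine (muX' (~` nball nrm 0 t)))
  (q + 1) c rk pmax Cm d m0 q10 hd c0 rk0 m00 Cm0
  (fun x r => le1 _ (mB x r))
  (fun x r r' rr => mono _ _ (mB x r) (mB x r') (fun y yr => le_trans yr rr))
  (fun x Ux => introT andP (conj (pU Ux) (hpm x Ux)))
  (is_norm_ge0 hn) hlb (fun t => le1 _ (measurableC (mB 0 t))) htail
  ltac:(by move=> x t r tr; rewrite -fineC//; apply: mono;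
    [exact/measurableC|exact/measurableC|apply: subsetC; exact: nball_subset]).
(* The first factor comes from [moment_of_tail], the second from (1 + |x|)^q <= 2^q (1 + |x|^q). *)
exists ((1 + K * 2 `^ (q + 1)) * 2 `^ q), M0; split => //.
  by rewrite mulr_ge0 ?powR_ge0// addr_ge0// mulr_ge0 ?powR_ge0.
move=> x M b Ux MM.
have M0' : (0 < M)%N by rewrite (leq_trans M00).
have px := pU Ux.
have Mp : 0 < M%:R * p x by rewrite mulr_gt0// ltr0n.
have n0 : 0 <= nrm x by exact: is_norm_ge0.
have d0 : 0 < d%:R :> R by rewrite ltr0n.
(* The typical scale of the distance to a block: [HK] says that the tail at r is at most K
   (s/r)^(q+1). *)
pose s := (1 + nrm x) / (M%:R * p x) `^ d%:R^-1.
have s0 : 0 < s by rewrite divr_gt0 ?powR_gt0// ltr_pwDl.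
have sE (t : R) : s `^ t = (1 + nrm x) `^ t / (M%:R * p x) `^ (t / d%:R).
  rewrite /s powRM ?invr_ge0 ?powR_ge0 ?addr_ge0//; congr (_ * _).
  by rewrite -powR_inv1 ?powR_ge0// -!powRrM -powRN; congr (_ `^ _); ring.
have mN : measurable_fun setT (fun w => blockmin (fun j => nrm (x - X' j w)) M b).
  apply: (@measurable_blockmin _ _ _ (fun j w => nrm (x - X' j w))) => j.
  apply: (measurableT_comp (measurable_is_norm hn)).
  by apply: measurable_rV_sub => //; exact: measurable_cst.
apply: (le_trans (@moment_of_tail _ _ _ P _ q s K mN _ q0 s0 K0 _)).
- by move=> w; apply: blockmin_ge0 => j; exact: is_norm_ge0.
- move=> r r0.
  rewrite (_ : [set w | _] = \bigcap_(j in [set` iota (b * M) M]) (X' j @^-1` (~` nball nrm x r))).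
    rewrite (iid_block (b * M) M hX') ?fineC//; last exact: measurableC.
    rewrite lee_fin; have := HK x M r Ux MM r0.
    have -> : (s / r) `^ (q + 1) = s `^ (q + 1) / r `^ (q + 1).
      rewrite powRM ?invr_ge0 ?(ltW s0) ?(ltW r0)//; congr (_ * _).
      by rewrite -[r^-1]powR_inv1 ?(ltW r0)// -powRrM mulN1r powRN.
    rewrite sE.
    have A0 : 0 < (M%:R * p x) `^ ((q + 1) / d%:R) by rewrite powR_gt0.
    have B0 : 0 < r `^ (q + 1) by rewrite powR_gt0.
    by rewrite -ler_pdivlMr// -ler_pdivlMr// !mulrA [_ / _ / _]mulrAC.
  apply/seteqP; split => [w|w h] /=.
    move=> /(lt_blockminP _ _ _ M0') h i; rewrite /= mem_iota => /andP[bi ib].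
    rewrite /nball/=; apply/negP; rewrite -ltNge -(subnKC bi); apply: h.
    by rewrite ltn_subLR.
  apply/(lt_blockminP _ _ _ M0') => j jM; rewrite ltNge; apply/negP.
  by apply: h; rewrite /= mem_iota leq_addr ltn_add2l.
rewrite lee_fin -[X in _ <= X]mulrA -[X in _ <= X]mulrA ler_wpM2l//.
  by rewrite addr_ge0// mulr_ge0 ?powR_ge0.
rewrite sE powRM ?(ltW px)// invfM powRN.
have -> : 2 `^ q * ((M%:R `^ (q / d%:R))^-1 * ((1 + nrm x `^ q) / p x `^ (q / d%:R))) =
  2 `^ q * (1 + nrm x `^ q) * ((M%:R `^ (q / d%:R))^-1 / p x `^ (q / d%:R)) by ring.
rewrite ler_wpM2r ?mulr_ge0 ?invr_ge0 ?powR_ge0//.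
by have := powR_addr_le (ltW q0) ler01 n0; rewrite powR1.
Qed.

End nearest_neighbour_moment.

(* Freezing X_i: the pair (X_i, omega) has a product law when the second copy of Omega
   carries only the sigma-algebra generated by X'. *)
Lemma integral_blockmin_samples (R : realType) (d : nat) (nrm : 'rV[R]_d -> R)
    (muX : probability 'rV[R]_d R) (disp : measure_display) (Omega : measurableType disp)
    (P : probability Omega R) (X X' : nat -> {RV P >-> 'rV[R]_d}) (U : set 'rV[R]_d)
    (g : 'rV[R]_d -> \bar R) (q : R) (M b i : nat) :
  is_norm nrm -> has_law (X i) muX -> independent_samples X X' ->
  measurable U -> muX (~` U) = 0%E -> measurable_fun setT g -> (forall x, (0 <= g x)%E) ->
  (forall x, U x ->
    (\int[P]_w (blockmin (fun j => nrm (x - X' j w)) M b `^ q)%:E <= g x)%E) ->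
  (\int[P]_w (blockmin (fun j => nrm (X i w - X' j w)) M b `^ q)%:E <=
    \int[muX]_x g x)%E.
Proof.
move=> hn lawX ind mU U0 mg g0 H.
pose G : set (set Omega) := \bigcup_j preimage_set_system setT (X' j) measurable.
pose T2 := g_sigma_algebraType G.
have mid : measurable_fun setT (id : Omega -> T2).
  move=> _ A sA; rewrite setTI; move: A sA; apply: smallest_sub.
    exact: sigma_algebra_measurable.
  by move=> _ [j _ [B mB <-]]; exact: (measurable_funP (X' j) measurableT B mB).
pose Z2 : {RV P >-> T2} := mfun_Sub (mem_set mid).
have mX' j : measurable_fun setT (X' j : T2 -> 'rV[R]_d).
  by move=> _ B mB; apply: sub_sigma_algebra; exists j => //; exists B.
pose F (z : 'rV[R]_d * T2) : \bar R :=
  (blockmin (fun j => nrm (z.1 - X' j z.2)) M b `^ q)%:E.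
have mF : measurable_fun setT F.
  apply/measurable_EFinP; apply: (measurableT_comp (measurable_powR q)).
  apply: (@measurable_blockmin _ _ _ (fun j (z : 'rV[R]_d * T2) => nrm (z.1 - X' j z.2))) => j.
  apply: (measurableT_comp (measurable_is_norm hn)).
  apply: measurable_rV_sub; first exact: measurable_fst.
  exact: (measurableT_comp (mX' j) measurable_snd).
have F0 z : (0 <= F z)%E by rewrite lee_fin powR_ge0.
have indXZ A B : measurable A -> measurable B ->
    P (X i @^-1` A `&` Z2 @^-1` B) = (muX A * distribution P Z2 B)%E.
  move=> mA mB; rewrite -(lawX A mA); apply: ind => //.
  by apply: sub_sigma_algebra; exists i => //; exists A => //; rewrite setTI.
rewrite (@integral_indep _ _ _ _ _ _ _ P muX (distribution P Z2) (X i) Z2 F)//.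
have mI := measurable_fun_fubini_tonelli_F F mF F0 (m2 := distribution P Z2).
apply: ae_ge0_le_integral => //.
- by move=> x _; apply: integral_ge0 => y _; exact: F0.
- exists (~` U); split => //; first exact: measurableC.
  move=> x /= /not_implyP[_ nle] Ux; apply: nle.
  rewrite ge0_integral_distribution//; last first.
    by apply: (measurableT_comp mF); exact: measurable_pair1.
  exact: H.
Qed.

(** * The estimator as an average over neighbours, and its distance to the sample mean *)

(** After exchanging the sums, the sum over j selects the neighbour's index, which is below m
    because l < k <= m. *)
Lemma QI_estimatorE (R : realType) (d e : nat) (nrm : 'rV[R]_d -> R)
    (f : 'rV[R]_d -> 'rV[R]_e) (phi : 'rV[R]_e -> R) (k m n : nat)
    (x x' : nat -> 'rV[R]_d) : (0 < k <= m)%N ->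
  QI_estimator nrm f phi k m n x x' =
  n%:R^-1 * \sum_(i < n) (k%:R^-1 * \sum_(l < k) phi (f (x' (nn_index nrm m x' (x i) l)))).
Proof.
move=> /andP[k0 km]; have m0 : (0 < m)%N by exact: leq_trans km.
rewrite /QI_estimator /nn_weight.
rewrite (eq_bigr (fun j : 'I_m => (m%:R / (k%:R * n%:R)) * \sum_(i < n) \sum_(l < k)
    ((j == nn_index nrm m x' (x i) l :> nat)%:R * phi (f (x' j))))); last first.
  move=> j _; rewrite -[LHS]mulrA; congr (_ * _); rewrite mulr_suml.
  by apply: eq_bigr => i _; rewrite mulr_suml.
rewrite -mulr_sumr mulrA (_ : m%:R^-1 * _ = n%:R^-1 * k%:R^-1); last first.
  by rewrite mulrA mulVf ?pnatr_eq0 -?lt0n// mul1r invfM mulrC.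
rewrite -mulrA; congr (_ * _); rewrite exchange_big/= mulr_sumr.
apply: eq_bigr => i _; congr (_ * _); rewrite exchange_big/=.
apply: eq_bigr => l _.
have lm : (nn_index nrm m x' (x i) l < m)%N.
  by apply: nn_index_lt; exact: leq_trans (ltn_ord l) km.
rewrite (bigD1 (Ordinal lm))//= eqxx mul1r big1 ?addr0// => j jl.
by case: eqP => [E|_]; [case/eqP: jl; exact: val_inj|rewrite mul0r].
Qed.

(** Lipschitz continuity bounds each difference by a neighbour distance; Jensen, over the sample and
    then over the k neighbours, moves the power q inside, and [blockmin_powR_sum] replaces each
    distance by block minima. *)
Lemma QI_estimator_error (R : realType) (d e : nat) (nrm : 'rV[R]_d -> R)
    (f : 'rV[R]_d -> 'rV[R]_e) (phi : 'rV[R]_e -> R) (L q : R) (k m n M : nat)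
    (x x' : nat -> 'rV[R]_d) :
  is_norm nrm -> 1 <= q -> 0 <= L ->
  (forall y z, `|phi (f y) - phi (f z)| <= L * nrm (y - z)) ->
  (0 < n)%N -> (0 < k <= m)%N -> (0 < M)%N -> (2 * k * M <= m)%N ->
  `|n%:R^-1 * \sum_(i < n) phi (f (x i)) - QI_estimator nrm f phi k m n x x'| `^ q <=
  n%:R^-1 * \sum_(i < n) (L `^ q *
    (k%:R^-1 * \sum_(b < 2 * k) blockmin (fun j => nrm (x i - x' j)) M b `^ q)).
Proof.
move=> hn q1 L0 hL n0 /[dup] km /andP[k0 k_le_m] M0 kM.
have q0 : 0 <= q by exact: le_trans q1.
have kR : 0 < k%:R :> R by rewrite ltr0n.
pose D i l := nrm (x i - x' (nn_index nrm m x' (x i) l)).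
have D0 i l : 0 <= D i l by exact: is_norm_ge0.
pose a i := k%:R^-1 * \sum_(l < k) (L * D i l).
have a0 i : 0 <= a i.
  by rewrite mulr_ge0 ?invr_ge0// sumr_ge0// => l _; rewrite mulr_ge0.
apply: (@le_trans _ _ ((n%:R^-1 * \sum_(i < n) a i) `^ q)).
  apply: ge0_ler_powR; rewrite ?nnegrE ?mulr_ge0 ?invr_ge0 ?sumr_ge0//.
  rewrite QI_estimatorE// -mulrBr normrM ger0_norm ?invr_ge0// ler_wpM2l ?invr_ge0//.
  rewrite -sumrB (le_trans (ler_norm_sum _ _ _))//; apply: ler_sum => i _.
  rewrite (_ : phi (f (x i)) = k%:R^-1 * \sum_(l < k) phi (f (x i))); last first.
    by rewrite sumr_const card_ord -[phi _ *+ k]mulr_natl mulrA mulVf ?gt_eqF// mul1r.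
  rewrite -mulrBr normrM ger0_norm ?invr_ge0// ler_wpM2l ?invr_ge0//.
  rewrite -sumrB (le_trans (ler_norm_sum _ _ _))//; apply: ler_sum => l _.
  exact: hL.
apply: (le_trans (powR_mean q1 n0 a0)); rewrite ler_wpM2l ?invr_ge0//.
apply: ler_sum => i _.
have LD0 l : 0 <= L * D i l by rewrite mulr_ge0.
apply: (le_trans (powR_mean q1 k0 LD0)).
(* The block bound is the same for every l, so the target is written as a sum of k equal terms and
   compared termwise. *)
rewrite ler_pdivrMl//.
rewrite (_ : k%:R * _ = \sum_(l < k) (L `^ q *
    (k%:R^-1 * \sum_(b < 2 * k) blockmin (fun j => nrm (x i - x' j)) M b `^ q))); last first.
  by rewrite sumr_const card_ord mulr_natl.
apply: ler_sum => l _; rewrite powRM//; apply: ler_wpM2l; first exact: powR_ge0.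
rewrite ler_pdivlMl//; apply: (@blockmin_powR_sum _ _ q (D i l) M k m l) => //.
  by move=> j; exact: is_norm_ge0.
by apply: count_closer_nn_index; exact: leq_trans (ltn_ord l) k_le_m.
Qed.

(** * Change of variables and moments of the sample mean *)

Lemma ge0_integral_law (disp disp' : measure_display) (Omega : measurableType disp)
    (T : measurableType disp') (R : realType) (P : probability Omega R)
    (Z : {RV P >-> T}) (mu : probability T R) (F : T -> \bar R) :
  has_law Z mu -> measurable_fun setT F -> (forall x, (0 <= F x)%E) ->
  (\int[P]_w F (Z w) = \int[mu]_x F x)%E.
Proof.
move=> lawZ mF F0; rewrite -[LHS](ge0_integral_distribution Z mF F0).
by apply: eq_measure_integral => A mA _; exact: lawZ.
Qed.

Lemma integral_law (disp disp' : measure_display) (Omega : measurableType disp)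
    (T : measurableType disp') (R : realType) (P : probability Omega R)
    (Z : {RV P >-> T}) (mu : probability T R) (F : T -> \bar R) :
  has_law Z mu -> mu.-integrable setT F -> (\int[P]_w F (Z w) = \int[mu]_x F x)%E.
Proof.
move=> lawZ /integrableP[mF iF]; rewrite -[LHS]integral_distribution//.
  by apply: eq_measure_integral => A mA _; exact: lawZ.
apply/integrableP; split; first exact: measurableT_comp.
rewrite (@ge0_integral_law _ _ _ _ _ _ _ mu (fun x => `|F x|%E))//.
exact: measurableT_comp.
Qed.

(** The n^(q/2) growth given by [moment_sum_independent], divided by n^q. *)
Lemma sample_mean_moment (disp disp' : measure_display) (Omega : measurableType disp)
    (T : measurableType disp') (R : realType) (P : probability Omega R)
    (Z : nat -> {RV P >-> T}) (mu : probability T R) (h : T -> R) (q : R) :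
  2 <= q -> iid Z mu -> measurable_fun setT h ->
  mu.-integrable setT (EFin \o h) -> (\int[mu]_x (h x)%:E = 0)%E ->
  (\int[mu]_x (`|h x| `^ q)%:E < +oo)%E ->
  exists2 K : R, 0 <= K & forall n, (0 < n)%N ->
    (\int[P]_w (`|n%:R^-1 * \sum_(i < n) h (Z i w)| `^ q)%:E <=
      (K * n%:R `^ (- (q / 2)))%:E)%E.
Proof.
move=> q2 [indZ lawZ] mh ih h0 hq.
have mpow (g : T -> R) : measurable_fun setT g ->
    measurable_fun setT (fun x => (`|g x| `^ q)%:E).
  move=> mg; apply/measurable_EFinP; apply: (measurableT_comp (measurable_powR q)).
  exact: measurableT_comp.
set s := (\int[mu]_x _)%E in hq.
have s0 : (0 <= s)%E by apply: integral_ge0 => x _; rewrite lee_fin powR_ge0.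
have sE : s = (fine s)%:E by rewrite fineK// ge0_fin_numE.
have hs i : (\int[P]_w (`|h (Z i w)| `^ q)%:E <= (fine s)%:E)%E.
  rewrite (@ge0_integral_law _ _ _ _ _ _ _ mu (fun x => (`|h x| `^ q)%:E)) -?sE//.
  exact: mpow.
have h0' i : (\int[P]_w (h (Z i w))%:E = 0)%E.
  by rewrite (@integral_law _ _ _ _ _ _ _ mu (EFin \o h)).
have [K K0 HK] := moment_sum_independent indZ q2 mh hs h0'.
exists (K * fine s); first by rewrite mulr_ge0// fine_ge0.
move=> n n0; have nR : 0 < n%:R :> R by rewrite ltr0n.
have e w : (`|n%:R^-1 * \sum_(i < n) h (Z i w)| `^ q)%:E =
    ((n%:R `^ (- q))%:E * (`|\sum_(i < n) h (Z i w)| `^ q)%:E)%E.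
  rewrite -EFinM normrM powRM// ger0_norm ?invr_ge0 ?(ltW nR)//.
  by rewrite -[n%:R^-1]powR_inv1 ?(ltW nR)// -powRrM mulN1r.
under eq_integral do rewrite e.
have mS : measurable_fun setT (fun w => \sum_(i < n) h (Z i w)).
  by apply: measurable_sum => i; exact: measurableT_comp.
rewrite ge0_integralZl_EFin ?powR_ge0//; last first.
  apply/measurable_EFinP; apply: (measurableT_comp (measurable_powR q)).
  exact: measurableT_comp.
apply: (le_trans (lee_wpmul2l _ (HK n n0))); first by rewrite lee_fin powR_ge0.
rewrite -EFinM lee_fin (_ : - (q / 2) = - q + q / 2); last by field.
rewrite powRD; last by rewrite (gt_eqF nR) implybT.
by rewrite le_eqVlt; apply/orP; left; apply/eqP; ring.
Qed.

Lemma integral_sum_le (disp : measure_display) (T : measurableType disp) (R : realType)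
    (P : {measure set T -> \bar R}) (n : nat) (F : nat -> T -> R) (t : R) :
  (forall i, measurable_fun setT (F i)) -> (forall i x, 0 <= F i x) ->
  (forall i, (\int[P]_x (F i x)%:E <= t%:E)%E) ->
  (\int[P]_x (\sum_(i < n) F i x)%:E <= (n%:R * t)%:E)%E.
Proof.
move=> mF F0 Ft; under eq_integral do rewrite -sumEFin.
rewrite ge0_integral_sum//; last 2 first.
- by move=> i; exact/measurable_EFinP.
- by move=> i x _; rewrite lee_fin.
apply: (@le_trans _ _ (\sum_(i < n) t%:E)%E); first exact: lee_sum.
by rewrite sumEFin sumr_const card_ord mulr_natl.
Qed.

(** * Combination of the sampling error and the neighbour error *)

Theorem proposition4p3 (R : realType) (d e : nat) (hd : (0 < d)%N)
    (nrm : 'rV[R]_d -> R) (hnrm : is_norm nrm)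
    (muX muX' : probability 'rV[R]_d R)
    (disp : measure_display) (Omega : measurableType disp)
    (P : probability Omega R)
    (X X' : nat -> {RV P >-> 'rV[R]_d})
    (hX : iid X muX) (hX' : iid X' muX') (hXX' : independent_samples X X')
    (tau : nat -> R)
    (htau0 : forall n, (0 < n)%N -> 0 <= tau n)
    (htau : exists (C : R) (N : nat), forall n, (N <= n)%N ->
      (\int[P]_w W1 nrm muX (empirical_measure (fun i => X i w) n)
        <= (C * tau n)%:E)%E)
    (f : 'rV[R]_d -> 'rV[R]_e) (phi : 'rV[R]_e -> R)
    (hf : measurable_fun [set: 'rV[R]_d] f)
    (hphi : measurable_fun [set: 'rV[R]_e] phi)
    (hLip : exists L : R, forall x y,
      `|phi (f x) - phi (f y)| <= L * nrm (x - y))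
    (q : R) (hq : 2 <= q)
    (ha : exists m0 : nat, (0 < m0)%N /\
      (\int[P]_w (\big[mine/+oo]_(j < m0) (nrm (X' j w))%:E) < +oo)%E)
    (U : set 'rV[R]_d) (hU : open U) (hsupp : msupp nrm muX `<=` U)
    (p : 'rV[R]_d -> R)
    (hbi : has_density (fun A => muX' (A `&` U)) (lebesgue_rV R d) p)
    (hbii : {within U, continuous p} /\ (forall x, U x -> 0 < p x))
    (hbiii : exists kappa rk : R, [/\ 0 < kappa, kappa <= 1, 0 < rk &
      forall (x : 'rV[R]_d) (r : R), U x -> 0 <= r -> r <= rk ->
        (kappa%:E * (p x)%:E * unit_ball_volume nrm * (r ^+ d)%:E
          <= muX' (nball nrm x r))%E])
    (hc : ('E_muX[fun x => ((1 + nrm x `^ q) / (p x `^ (q / d%:R)))%R] < +oo)%E)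
    (k : nat -> nat)
    (hk1 : forall m, (0 < m)%N -> (0 < k m <= m)%N)
    (hk2 : forall m m', (0 < m <= m')%N -> (k m <= k m')%N)
    (hk3 : ((k m)%:R / m%:R : R) @[m --> \oo] --> (0 : R)) :
  exists (A B : nat -> nat -> R) (C1 C2 : R) (M N : nat),
    [/\ (forall m n, (M <= m)%N -> (N <= n)%N ->
          (('E_P[fun w => (`|QI muX f phi -
                QI_estimator nrm f phi (k m) m n
                  (fun i => X i w) (fun j => X' j w)| `^ q)%R]) `^ q^-1)%E
          = (A m n + B m n)%:E),
        (forall m n, (N <= n)%N ->
          `|A m n| <= C1 * ((Num.sqrt n%:R)^-1 + tau n)) &
        (forall m n, (M <= m)%N ->
          `|B m n| <= C2 * ((k m)%:R / m%:R) `^ (d%:R^-1))].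
Proof.
have q0 : 0 < q by lra.
have q1 : 1 <= q by lra.
have d0 : 0 < d%:R :> R by rewrite ltr0n.
have [L0 hL0] := hLip; pose L := `|L0|; have Lge0 : 0 <= L by exact: normr_ge0.
have hL x y : `|phi (f x) - phi (f y)| <= L * nrm (x - y).
  by rewrite (le_trans (hL0 x y))// ler_wpM2r ?is_norm_ge0// ler_norm.
pose g x := phi (f x).
have mg : measurable_fun setT g by exact: measurableT_comp.
have mnrm := measurable_is_norm hnrm.
have mU : measurable U by exact: sub_sigma_algebra.
have UC0 := msupp_open_null hnrm hU hsupp.
have [_ pU] := hbii; have [mp p0 _] := hbi.
have U0 : U !=set0.
  apply/set0P/eqP => UE; move: UC0; rewrite UE setC0 probability_setT => /eqP.
  by rewrite onee_eq0.
pose wt x : R := (1 + nrm x `^ q) / p x `^ (q / d%:R).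
have wt0 x : 0 <= wt x by rewrite mulr_ge0 ?invr_ge0 ?addr_ge0 ?powR_ge0.
have mnq : measurable_fun setT (fun x => nrm x `^ q).
  exact: (measurableT_comp (measurable_powR q)).
have mwt : measurable_fun setT wt.
  apply: measurable_funM; first by apply: measurable_funD => //; exact: mnq.
  rewrite (_ : (fun _ => _) = fun x => p x `^ (- (q / d%:R))).
    exact: (measurableT_comp (measurable_powR _)).
  by apply/funext => x; rewrite powRN.
have hc' : (\int[muX]_x (wt x)%:E < +oo)%E by move: hc; rewrite unlock.
set Ew := (\int[muX]_x (wt x)%:E)%E in hc'.
have Ew0 : (0 <= Ew)%E by apply: integral_ge0 => x _; rewrite lee_fin.
have EwE : Ew = (fine Ew)%:E by rewrite fineK// ge0_fin_numE.
have [pmax hpm] := density_bounded hnrm U0 pU hbiii.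
have pm0 : 0 < pmax by have [x Ux] := U0; exact: lt_le_trans (pU x Ux) (hpm x Ux).
(* Since p is bounded on U, (c) bounds the q-th moment of X. *)
have moment : (\int[muX]_x (1 + nrm x `^ q)%:E < +oo)%E.
  apply: (@le_lt_trans _ _ (\int[muX]_x ((pmax `^ (q / d%:R))%:E * (wt x)%:E))%E).
    apply: ae_ge0_le_integral => //.
    - by move=> x _; rewrite lee_fin addr_ge0// powR_ge0.
    - by apply/measurable_EFinP; exact: measurable_funD.
    - by move=> x _; rewrite mule_ge0// lee_fin// powR_ge0.
    - by apply: measurable_funeM; exact/measurable_EFinP.
    - exists (~` U); split => //; first exact: measurableC.
      move=> x /= /not_implyP[_ nle] Ux; apply: nle; rewrite -EFinM lee_fin /wt mulrCA.
      rewrite ler_peMr ?addr_ge0 ?powR_ge0// ler_pdivlMr ?powR_gt0 ?pU// mul1r.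
      apply: ge0_ler_powR; rewrite ?nnegrE ?(ltW pm0) ?hpm ?(ltW (pU _ _))//.
      by rewrite divr_ge0 ?(ltW q0).
  rewrite ge0_integralZl_EFin ?powR_ge0//; [|by move=> x _; rewrite lee_fin|exact/measurable_EFinP].
  by rewrite -/Ew EwE -EFinM ltry.
(* Growth of order 1 + |x|^q suffices for integrability; this serves for g, of linear growth, and
   for |g - QI|^q. *)
have dominated (h : 'rV[R]_d -> R) (C : R) : 0 <= C -> measurable_fun setT h ->
    (forall x, `|h x| <= C * (1 + nrm x `^ q)) -> muX.-integrable setT (EFin \o h).
  move=> C0 mh hh; apply/integrableP; split; first exact/measurable_EFinP.
  apply: (@le_lt_trans _ _ (\int[muX]_x (C%:E * (1 + nrm x `^ q)%:E))%E).
    by apply: ge0_le_integralT => x//; rewrite -EFinM lee_fin.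
  rewrite ge0_integralZl_EFin//; last 2 first.
  - by move=> x _; rewrite lee_fin addr_ge0// powR_ge0.
  - by apply/measurable_EFinP; exact: measurable_funD.
  by rewrite lte_mul_pinfty// ?lee_fin.
have ig : muX.-integrable setT (EFin \o g).
  apply: (dominated g (`|g 0| + L)) => //; first by rewrite addr_ge0.
  move=> x; have n1 := normr_le_powRD1 (nrm x) q1; rewrite ger0_norm ?is_norm_ge0// in n1.
  have := ler_normD (g x - g 0) (g 0); rewrite subrK => /le_trans; apply.
  have := hL x 0; rewrite subr0 -/(g x) -/(g 0) => gx.
  have nq0 := powR_ge0 (nrm x) q.
  have : L * nrm x <= L * (1 + nrm x `^ q) by rewrite ler_wpM2l.
  have : `|g 0| <= `|g 0| * (1 + nrm x `^ q) by rewrite ler_peMr// lerDl.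
  by move: gx; rewrite [X in _ -> _ -> _ -> _ <= X]mulrDl; lra.
set qi := QI muX f phi.
have gE : (\int[muX]_x (g x)%:E = qi%:E)%E.
  rewrite /qi /QI unlock fineK//; exact: integral_fune_fin_num.
pose h x := g x - qi.
have mh : measurable_fun setT h by apply: measurable_funB.
have iqi : muX.-integrable setT (EFin \o cst qi).
  exact: finite_measure_integrable_cst.
have ih : muX.-integrable setT (EFin \o h).
  exact: (integrableB measurableT ig iqi).
have h0 : (\int[muX]_x (h x)%:E = 0)%E.
  rewrite (eq_integral (fun x => (EFin \o g) x - (EFin \o cst qi) x)%E)//.
  rewrite integralB// gE; have := expectation_cst muX qi; rewrite unlock => ->.
  by rewrite subee.
have hq' : (\int[muX]_x (`|h x| `^ q)%:E < +oo)%E.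
  have := dominated (fun x => `|h x| `^ q) (2 `^ q * (`|g 0 - qi| `^ q + L `^ q)).
  case/(_ _ _ _)/integrableP.
  - by rewrite mulr_ge0 ?addr_ge0 ?powR_ge0.
  - apply: (measurableT_comp (measurable_powR q)); exact: measurableT_comp.
  - move=> x; rewrite ger0_norm ?powR_ge0//.
    apply: (@le_trans _ _ ((`|g 0 - qi| + L * nrm x) `^ q)).
      apply: ge0_ler_powR; rewrite ?nnegrE ?(ltW q0) ?addr_ge0 ?mulr_ge0 ?is_norm_ge0//.
      rewrite (_ : h x = (g 0 - qi) + (g x - g 0)); last by rewrite /h; ring.
      by rewrite (le_trans (ler_normD _ _))// lerD2l -[X in L * nrm X]subr0 hL.
    apply: (le_trans (powR_addr_le _ _ _)); rewrite ?(ltW q0) ?mulr_ge0 ?is_norm_ge0//.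
    rewrite -mulrA ler_wpM2l ?powR_ge0// powRM ?is_norm_ge0//.
    have := powR_ge0 `|g 0 - qi| q; have := powR_ge0 L q; have := powR_ge0 (nrm x) q.
    by move: (_ `^ q) (_ `^ q) (_ `^ q) => u v w; nra.
  move=> _; apply: le_lt_trans; rewrite le_eqVlt; apply/orP; left; apply/eqP.
  by apply: eq_integral => x _ /=; rewrite (ger0_norm (powR_ge0 _ _)).
have [K1 K10 HK1] := sample_mean_moment hq hX mh ih h0 hq'.
have [K2 [M0 [K20 M00 HK2]]] := nearest_neighbour_moment hd hnrm hX' ha U0 pU hbiii q0.
have block M b i : (M0 <= M)%N ->
    (\int[P]_w (blockmin (fun j => nrm (X i w - X' j w)) M b `^ q)%:E <=
      (K2 * fine Ew * M%:R `^ (- (q / d%:R)))%:E)%E.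
  move=> MM.
  have := @integral_blockmin_samples R d nrm muX disp Omega P X X' U
    (fun x => ((K2 * M%:R `^ (- (q / d%:R)))%:E * (wt x)%:E)%E) q M b i hnrm (hX.2 i) hXX' mU UC0.
  have c0 : 0 <= K2 * M%:R `^ (- (q / d%:R)) by rewrite mulr_ge0 ?powR_ge0.
  rewrite ge0_integralZl_EFin//; [|by move=> x _; rewrite lee_fin|exact/measurable_EFinP].
  rewrite -/Ew EwE -EFinM mulrAC; apply.
  - by apply: measurable_funeM; exact/measurable_EFinP.
  - by move=> x; rewrite -EFinM lee_fin mulr_ge0.
  - by move=> x Ux; rewrite -EFinM; exact: HK2.
set C3 := K2 * fine Ew in block; have C30 : 0 <= C3 by rewrite mulr_ge0// fine_ge0.
clearbody C3.
(* By (d), k_m / m is eventually below 1/(2 M0), so each of the 2 k_m blocks can hold at least M0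
   points. *)
have [Mt HMt] : exists Mt, forall m, (Mt <= m)%N -> (0 < m)%N /\ (2 * k m * M0 <= m)%N.
  have e0 : 0 < (2 * M0%:R)^-1 :> R by rewrite invr_gt0 mulr_gt0// ltr0n.
  have /cvgrPdist_lt/(_ _ e0)[Mt _ H] := hk3.
  exists (maxn Mt 1) => m; rewrite geq_max => /andP[Mm m0]; split => //.
  have mR : 0 < m%:R :> R by rewrite ltr0n.
  have := H m Mm; rewrite /= sub0r normrN ger0_norm; last by rewrite divr_ge0.
  rewrite ltr_pdivrMr// ltr_pdivlMl ?mulr_gt0 ?ltr0n// => kmm.
  by rewrite -(ler_nat R) !natrM; move: kmm; lra.
(* The 2 is the ratio of 2k blocks to k neighbours; 4^(q/d) comes from M >= m/(4k). *)
pose D2 := 2 * (L `^ q * C3) * 4 `^ (q / d%:R).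
have D20 : 0 <= D2 by rewrite !mulr_ge0 ?powR_ge0.
pose W m n w := `|qi - QI_estimator nrm f phi (k m) m n
  (fun i => X i w) (fun j => X' j w)| `^ q.
have main m n : (Mt <= m)%N -> (0 < n)%N ->
    (\int[P]_w (W m n w)%:E <= (2 `^ q * (K1 * n%:R `^ (- (q / 2)) +
      D2 * ((k m)%:R / m%:R) `^ (q / d%:R)))%:E)%E.
  move=> Mm n0; have [m0 kM0] := HMt m Mm; have km := hk1 m m0.
  have /andP[k0 k_le_m] := km; pose M := (m %/ (2 * k m))%N.
  have k20 : (0 < 2 * k m)%N by rewrite muln_gt0.
  have M0M : (M0 <= M)%N by rewrite leq_divRL// mulnC.
  have Mgt0 : (0 < M)%N by rewrite (leq_trans M00).
  have kMm : (2 * k m * M <= m)%N by rewrite mulnC leq_trunc_div.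
  have nR : 0 < n%:R :> R by rewrite ltr0n.
  have kR : 0 < (k m)%:R :> R by rewrite ltr0n.
  have mR : 0 < m%:R :> R by rewrite ltr0n.
  have MR : 0 < M%:R :> R by rewrite ltr0n.
  (* Euclidean division gives m <= (M + 1) 2k <= 2M 2k, hence 1/M <= 4k/m. *)
  have Mpow : M%:R `^ (- (q / d%:R)) <= 4 `^ (q / d%:R) * ((k m)%:R / m%:R) `^ (q / d%:R).
    rewrite -[- (q / _)]mulN1r [_ `^ (-1 * _)]powRrM powR_inv1 ?(ltW MR)//.
    rewrite -[leRHS]powRM ?divr_ge0//.
    apply: ge0_ler_powR; rewrite ?nnegrE ?invr_ge0 ?mulr_ge0 ?divr_ge0 ?(ltW q0)//.
    rewrite mulrA ler_pdivlMr// ler_pdivrMl//.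
    have : (m <= 2 * M * (2 * k m))%N.
      apply: (leq_trans (ltnW (ltn_ceil m k20))); rewrite leq_mul2r -/M; apply/orP; right.
      by rewrite mul2n -addnn -addn1 leq_add2l.
    by rewrite -(ler_nat R) !natrM; lra.
  pose B i b w := blockmin (fun j => nrm (X i w - X' j w)) M b `^ q.
  have mB i b : measurable_fun setT (B i b).
    apply: (measurableT_comp (measurable_powR q)).
    apply: (@measurable_blockmin _ _ _ (fun j w => nrm (X i w - X' j w))) => j.
    by apply: (measurableT_comp mnrm); exact: measurable_rV_sub.
  have B0 i b w : 0 <= B i b w by exact: powR_ge0.
  pose S w := \sum_(i < n) \sum_(b < 2 * k m) B i b w.
  have S0 w : 0 <= S w by rewrite sumr_ge0// => i _; rewrite sumr_ge0.
  have mSi i : measurable_fun setT (fun w => \sum_(b < 2 * k m) B i b w).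
    by apply: measurable_sum => b.
  have mS : measurable_fun setT S by apply: measurable_sum => i.
  have intS : (\int[P]_w (S w)%:E <= (n%:R * ((2 * k m)%:R *
      (C3 * M%:R `^ (- (q / d%:R)))))%:E)%E.
    apply: (@integral_sum_le _ _ _ P n (fun i w => \sum_(b < 2 * k m) B i b w)) => //.
      by move=> i w; rewrite sumr_ge0.
    by move=> i; apply: integral_sum_le => // b; exact: block.
  pose A w := `|n%:R^-1 * \sum_(i < n) h (X i w)| `^ q.
  have A0 w : 0 <= A w by exact: powR_ge0.
  have mA : measurable_fun setT A.
    apply: (measurableT_comp (measurable_powR q)); apply: measurableT_comp => //.
    apply: measurable_funM => //; apply: measurable_sum => i; exact: measurableT_comp.
  pose c := n%:R^-1 * (L `^ q * (k m)%:R^-1).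
  have c0 : 0 <= c by rewrite !mulr_ge0 ?invr_ge0 ?powR_ge0.
  have q2 : 0 <= 2 `^ q :> R by exact: powR_ge0.
  (* The error is split at the sample mean of g; the power of the sum costs 2^q. *)
  apply: (@le_trans _ _ (\int[P]_w ((2 `^ q)%:E * ((A w)%:E + c%:E * (S w)%:E)))%E).
    apply: ge0_le_integralT => w; first by rewrite lee_fin powR_ge0.
    rewrite -[(c%:E * _)%E]EFinM -EFinD -EFinM lee_fin /W.
    have -> : c * S w = n%:R^-1 * \sum_(i < n) (L `^ q *
        ((k m)%:R^-1 * \sum_(b < 2 * k m) B i b w)).
      rewrite /c -mulrA; congr (_ * _); rewrite /S mulr_sumr.
      by apply: eq_bigr => i _; rewrite mulrA.
    apply: le_trans (ler_wpM2l q2 (lerD (lexx (A w)) (QI_estimator_error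
      (fun i => X i w) (fun j => X' j w) hnrm q1 Lge0 hL n0 km Mgt0 kMm))).
    apply: (le_trans _ (powR_addr_le (ltW q0) (normr_ge0 _) (normr_ge0 _))).
    apply: ge0_ler_powR; rewrite ?nnegrE ?(ltW q0) ?addr_ge0//.
    rewrite -[X in _ <= X + _]normrN; apply: le_trans (ler_normD _ _).
    rewrite le_eqVlt; apply/orP; left; apply/eqP; congr (`| _ |).
    rewrite addrA; congr (_ - _); rewrite /h sumrB sumr_const card_ord mulrBr.
    by rewrite -[qi *+ n]mulr_natl mulKf ?gt_eqF// /g opprB subrK.
  rewrite ge0_integralZl_EFin//; last 2 first.
  - by move=> w _; rewrite -EFinM -EFinD lee_fin addr_ge0// mulr_ge0.
  - apply: emeasurable_funD; first exact/measurable_EFinP.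
    by apply: measurable_funeM; exact/measurable_EFinP.
  rewrite [leRHS]EFinM lee_wpmul2l ?lee_fin//.
  rewrite ge0_integralD//; last 4 first.
  - by move=> w _; rewrite lee_fin.
  - exact/measurable_EFinP.
  - by move=> w _; rewrite -EFinM lee_fin mulr_ge0.
  - by apply: measurable_funeM; exact/measurable_EFinP.
  rewrite EFinD; apply: leeD; first exact: HK1.
  rewrite ge0_integralZl_EFin//; last 2 first.
  - by move=> w _; rewrite lee_fin.
  - exact/measurable_EFinP.
  apply: (le_trans (lee_wpmul2l _ intS)); first by rewrite lee_fin.
  rewrite -EFinM lee_fin /c natrM.
  rewrite [leLHS](_ : _ = 2 * (L `^ q * C3) * M%:R `^ (- (q / d%:R))); last first.
    by move: (M%:R `^ _) => z; field; rewrite !gt_eqF.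
  by rewrite /D2 -[leRHS]mulrA ler_wpM2l// !mulr_ge0 ?powR_ge0.
clearbody D2; have K1' : 0 <= 2 `^ q * K1 by rewrite mulr_ge0 ?powR_ge0.
have D2' : 0 <= 2 `^ q * D2 by rewrite mulr_ge0 ?powR_ge0.
(* The q-th root of the two-term bound is split by [powR_addr_le] with exponent 1/q, whence the
   factor 2^(1/q) in both constants. *)
pose r := q^-1; have r0 : 0 <= r by rewrite invr_ge0 ltW.
pose C1 := 2 `^ r * (2 `^ q * K1) `^ r; pose C2 := 2 `^ r * (2 `^ q * D2) `^ r.
have C10 : 0 <= C1 by rewrite mulr_ge0 ?powR_ge0.
have C20 : 0 <= C2 by rewrite mulr_ge0 ?powR_ge0.
pose err m n := fine (('E_P[W m n]) `^ r)%E.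
have err0 m n : 0 <= err m n by rewrite fine_ge0// poweR_ge0.
have errP m n : (Mt <= m)%N -> (0 < n)%N ->
    ('E_P[W m n] `^ r)%E = (err m n)%:E /\
    err m n <= C1 * (Num.sqrt n%:R)^-1 + C2 * ((k m)%:R / m%:R) `^ d%:R^-1.
  move=> Mm n0; have H := main m n Mm n0; rewrite /err unlock.
  have I0 : (0 <= \int[P]_w (W m n w)%:E)%E.
    by apply: integral_ge0 => w _; rewrite lee_fin powR_ge0.
  have Ifin : (\int[P]_w (W m n w)%:E)%E \is a fin_num.
    by rewrite ge0_fin_numE// (le_lt_trans H)// ltry.
  move: H I0; rewrite -(fineK Ifin) poweR_EFin !lee_fin/= => H I0; split => //.
  set z := (k m)%:R / m%:R in H *; have z0 : 0 <= z by rewrite divr_ge0.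
  apply: (@le_trans _ _ ((2 `^ q * K1 * n%:R `^ (- (q / 2)) +
      2 `^ q * D2 * z `^ (q / d%:R)) `^ r)).
    apply: ge0_ler_powR; rewrite ?nnegrE ?addr_ge0 ?mulr_ge0 ?powR_ge0//.
    by apply: (le_trans H); rewrite mulrDr !mulrA.
  apply: (le_trans (powR_addr_le _ _ _)); rewrite ?mulr_ge0 ?powR_ge0//.
  rewrite /C1 /C2 mulrDr; move: (2 `^ q * K1) (2 `^ q * D2) K1' D2' => a1 a2 a10 a20.
  rewrite (powRM r a10 (powR_ge0 _ _)) (powRM r a20 (powR_ge0 _ _)) -!powRrM.
  rewrite (_ : - (q / 2) * r = - 2^-1); last by rewrite /r; field; rewrite gt_eqF.
  rewrite (_ : q / d%:R * r = d%:R^-1); last by rewrite /r; field; rewrite !gt_eqF.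
  by rewrite powRN powR12_sqrt// !mulrA.
clearbody C1 C2.
(* The error must equal A + B exactly, so A takes as much of it as C1 / sqrt n allows and B takes
   the rest. Both vanish outside the range of [errP], so that the bound on A holds for every m and
   the bound on B for every n. *)
pose A m n := if (Mt <= m)%N && (0 < n)%N then Num.min (err m n) (C1 * (Num.sqrt n%:R)^-1) else 0.
pose B m n := if (Mt <= m)%N && (0 < n)%N then err m n - A m n else 0.
exists A, B, C1, C2, Mt, 1%N; split.
- move=> m n Mm n0; have [E _] := errP m n Mm n0.
  by rewrite /B Mm n0/= addrC subrK -E.
- move=> m n n0; have t0 := htau0 n n0.
  have s0 : 0 <= (Num.sqrt n%:R)^-1 :> R by rewrite invr_ge0 sqrtr_ge0.
  rewrite /A n0 andbT; case: ifP => _; last by rewrite normr0 mulr_ge0 ?addr_ge0.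
  rewrite ger0_norm ?le_min ?err0 ?mulr_ge0//.
  by rewrite ge_min mulrDr lerDl mulr_ge0 ?orbT.
- move=> m n Mm; rewrite /B /A Mm andTb.
  case: ifP => n0; last by rewrite normr0 mulr_ge0 ?powR_ge0.
  have [_ E] := errP m n Mm n0; rewrite n0 ger0_norm ?subr_ge0 ?ge_min ?lexx//.
  rewrite lerBlDl; case: (leP (err m n) (C1 / Num.sqrt n%:R)) => _; last exact: E.
  by rewrite lerDl mulr_ge0 ?powR_ge0.
Qed.
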